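(* There are universal constants $k_1,k_2<\infty$ such that, for every positive integer $q$, every $\beta>0$, every integer $d\ge 2$ and every positive integer $L$, the mixing times of the heat bath chain and of the Swendsen-Wang chain for the $q$-state Potts model at inverse temperature $\beta$ on the torus $T_{L,d}=(\mathbb Z/L\mathbb Z)^d$ satisfy $$\tau^{\mathrm{HB}}(T_{L,d})\le e^{(k_1+k_2\beta)L^{d-1}}\qquad\text{and}\qquad \tau^{\mathrm{SW}}(T_{L,d})\le e^{(k_1+k_2\beta)L^{d-1}}.$$
   Context: Potts model: for a finite graph $G=(V,E)$, $\beta>0$ and a positive integer $q$, with $[q]=\{1,\dots,q\}$, the Gibbs measure on $[q]^V$ is $\mu_G(\sigma)=e^{-\beta H_G(\sigma)}/Z_G$, where $H_G(\sigma)=\sum_{xy\in E}(1-\delta(\sigma_x,\sigma_y))$, $\delta$ is the Kronecker delta and $Z_G=\sum_{\sigma\in[q]^V}e^{-\beta H_G(\sigma)}$. $T_{L,d}$ is the discrete torus with vertex set $(\mathbb Z/L\mathbb Z)^d$ and nearest-neighbour edges. Heat bath chain: from $\sigma\in[q]^V$, choose $v\in V$ uniformly at random, keep all spins other than $\sigma_v$, and resample the spin at $v$ from $\mu_G$ conditioned on the other spins, i.e. set $\sigma'_v=k$ with probability $\exp\{\beta\sum_{w:vw\in E}\delta(k,\sigma_w)\}\big/\sum_{l=1}^q\exp\{\beta\sum_{w:vw\in E}\delta(l,\sigma_w)\}$. Swendsen-Wang (SW) chain: from $\sigma\in[q]^V$, let $E(\sigma)=\{xy\in E:\sigma_x=\sigma_y\}$;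 delete each edge of $E(\sigma)$ independently with probability $1-p$, where $p=1-e^{-\beta}$, obtaining a random set $A\subset E(\sigma)$; then for each connected component of $(V,A)$ (isolated vertices included) choose independently a spin uniformly from $[q]$ and assign it to all vertices of the component. Mixing time: for an irreducible Markov chain with transition matrix $P$ on a finite state space $\Omega$ with stationary distribution $\mu$, $\tau=\min\{t: d(t)\le \frac1{2e}\}$, where $d(t)=\max_{\sigma\in\Omega}\max_{A\subset\Omega}|\mu(A)-\sum_{\sigma'\in A}P^t(\sigma,\sigma')|$. $\tau^{\mathrm{HB}}(T_{L,d})$ and $\tau^{\mathrm{SW}}(T_{L,d})$ denote the mixing times of the heat bath and SW chains on $G=T_{L,d}$. *)

(* Defs.v *)
From HB Require Import structures.
From mathcomp Require Import all_boot all_order all_algebra.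
From mathcomp Require Import boolp reals constructive_ereal sequences exp.

Set Implicit Arguments.
Unset Strict Implicit.
Unset Printing Implicit Defensive.

Import Order.TTheory GRing.Theory Num.Theory.
Local Open Scope ring_scope.

(* A finite simple graph on V is given by its edge set E : {set {set V}}, the
   edge between x and y being the unordered pair [set x; y]. *)

Section Torus.
Variables (L d : nat).

(* 'I_L rather than 'Z_L: the latter is Z/2Z when L = 1. The cyclic successor
   x + 1 mod L is ordS x. *)
Definition torus_vertex : finType := {ffun 'I_d -> 'I_L}.

Definition torus_neighbour (x y : torus_vertex) : bool :=
  [exists i : 'I_d,
     [forall j : 'I_d, (j != i) ==> (x j == y j)]
     && ((y i == ordS (x i)) || (x i == ordS (y i)))].

(* The condition x != y only matters for L = 1, where it discards loops. For
   L = 2 the neighbours x + e_i and x - e_i coincide and give a single edge. *)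
Definition torus_edges : {set {set torus_vertex}} :=
  [set [set x; y] | x in [set: torus_vertex],
                    y in [set y | (x != y) && torus_neighbour x y]].

End Torus.

Section MixingTime.
Variables (R : realType) (Omega : finType).
Variables (P : Omega -> Omega -> R) (mu : Omega -> R).

Definition nstep (t : nat) (s s' : Omega) : R :=
  ((\matrix_(i < #|Omega|, j < #|Omega|) P (enum_val i) (enum_val j)) ^+ t)
    (enum_rank s) (enum_rank s').

Definition mixing_distance (t : nat) : R :=
  \big[Num.max/0]_(s : Omega) \big[Num.max/0]_(A : {set Omega})
     `| \sum_(s' in A) mu s' - \sum_(s' in A) nstep t s s' |.

Definition is_mixed (t : nat) : bool :=
  mixing_distance t <= (2 * expR 1)^-1.

(* The minimum is +oo when the set of such times is empty. *)
Definition mixing_time : \bar R :=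
  if pselect (exists t, is_mixed t) is left ex_t
  then ((ex_minn ex_t)%:R)%:E else +oo%E.

End MixingTime.

Section Potts.
Variables (R : realType) (V : finType) (E : {set {set V}}).
Variables (q : nat) (beta : R).

Definition spin_config : finType := {ffun V -> 'I_q}.

Implicit Types (s : spin_config) (v : V) (k : 'I_q).

(* For e = [set x; y], this is s x == s y. *)
Definition monochromatic s (e : {set V}) : bool :=
  [forall x in e, forall y in e, s x == s y].

Definition potts_energy s : R := \sum_(e in E) (1 - (monochromatic s e)%:R).

Definition potts_weight s : R := expR (- beta * potts_energy s).

Definition gibbs s : R := potts_weight s / \sum_(s' : spin_config) potts_weight s'.

Definition set_spin s v k : spin_config :=
  [ffun x => if x == v then k else s x].

Definition local_weight s v k : R :=
  expR (beta * \sum_(w : V | [set v; w] \in E) (k == s w)%:R).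

Definition heat_bath s s' : R :=
  \sum_(v : V) #|V|%:R^-1 *
    \sum_(k : 'I_q) (local_weight s v k / \sum_(l : 'I_q) local_weight s v l)
                    * (s' == set_spin s v k)%:R.

Definition mono_edges s : {set {set V}} := [set e in E | monochromatic s e].

Definition components (A : {set {set V}}) : {set {set V}} :=
  equivalence_partition (connect [rel x y | [set x; y] \in A]) [set: V].

(* The spins of the components are independent and uniform, so the law of the
   new configuration is a product over the components. *)
Definition recolour_prob (A : {set {set V}}) s' : R :=
  \prod_(C in components A)
    \sum_(k : 'I_q) q%:R^-1 * [forall x in C, s' x == k]%:R.

Definition swendsen_wang s s' : R :=
  let p := 1 - expR (- beta) in
  \sum_(A : {set {set V}} | A \subset mono_edges s)
    p ^+ #|A| * (1 - p) ^+ #|mono_edges s :\: A| * recolour_prob A s'.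

End Potts.

Definition tau_HB (R : realType) (q : nat) (beta : R) (L d : nat) : \bar R :=
  mixing_time (@heat_bath R _ (torus_edges L d) q beta)
              (@gibbs R _ (torus_edges L d) q beta).

Definition tau_SW (R : realType) (q : nat) (beta : R) (L d : nat) : \bar R :=
  mixing_time (@swendsen_wang R _ (torus_edges L d) q beta)
              (@gibbs R _ (torus_edges L d) q beta).

(* Main.v *)
Require Import Defs.
From mathcomp Require Import all_boot all_order all_algebra.
From mathcomp Require Import boolp reals constructive_ereal sequences exp.
From mathcomp Require Import perm zify ring lra.

Set Implicit Arguments.
Unset Strict Implicit.
Unset Printing Implicit Defensive.

Import Order.TTheory GRing.Theory Num.Theory.
Local Open Scope ring_scope.

(* With sites ordered so that every initial segment has edge boundary at most
   w, move from s to t by flipping the sites in order. The map exchanging the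
   initial segments of s and t is an involution that changes mu(s) mu(t) by at
   most e^(2 beta w), and by colour symmetry the new spin at the flipped site
   is uniform under mu. This gives a Poincare inequality for single-site
   uniform resampling whose constant does not depend on q. It passes to the
   heat bath chain directly, and to the Swendsen-Wang chain because a site is
   isolated in the percolation configuration with probability at least
   e^(- beta deg) and is then resampled uniformly.

   Turning the spectral gap into a mixing time costs log (1 / min mu), of order
   |V| log q, which is harmless only while q is at most Q = 32 |V|^2 e^(beta
   deg). For q > Q the heat bath chain contracts site-Lipschitz functions, and
   the expected number of pairs of equally coloured sites decays under the
   Swendsen-Wang chain, whose next step from a rainbow configuration does not
   depend on that configuration.

   On the torus the lexicographic order has w <= 4 L^(d-1), and |V| = L^d is at
   most (L^(d-1))^2. *)

(** * Reversible chains and the Poincare inequality *)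

Section Expectation.
Variables (R : realFieldType) (Omega : finType) (mu : Omega -> R).
Implicit Types (f g : Omega -> R).

Definition expect f : R := \sum_s mu s * f s.
Definition variance f : R := expect (fun s => (f s - expect f) ^+ 2).

Lemma eq_expect f g : f =1 g -> expect f = expect g.
Proof. by move=> fg; apply: eq_bigr => s _; rewrite fg. Qed.

Lemma expectD f g : expect (fun s => f s + g s) = expect f + expect g.
Proof. by rewrite -big_split; apply: eq_bigr => s _; rewrite mulrDr. Qed.

Lemma expectZ c f : expect (fun s => c * f s) = c * expect f.
Proof. by rewrite mulr_sumr; apply: eq_bigr => s _; rewrite mulrCA. Qed.

Lemma expect_sum (I : Type) (r : seq I) (Q : pred I) (F : I -> Omega -> R) :
  expect (fun s => \sum_(i <- r | Q i) F i s) = \sum_(i <- r | Q i) expect (F i).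
Proof.
rewrite exchange_big; apply: eq_bigr => s _.
by rewrite mulr_sumr.
Qed.

Hypothesis mu_ge0 : forall s, 0 <= mu s.

Lemma ler_expect f g : (forall s, f s <= g s) -> expect f <= expect g.
Proof. by move=> fg; apply: ler_sum => s _; apply: ler_wpM2l. Qed.

Lemma expect_ge0 f : (forall s, 0 <= f s) -> 0 <= expect f.
Proof. by move=> f0; apply: sumr_ge0 => s _; apply: mulr_ge0. Qed.

Lemma ler_expect_at s f : (forall s, 0 <= f s) -> mu s * f s <= expect f.
Proof.
move=> f0; rewrite /expect (bigD1 s)//= lerDl.
by apply: sumr_ge0 => s' _; apply: mulr_ge0.
Qed.

Hypothesis mu1 : \sum_s mu s = 1.

Lemma expect_cst c : expect (fun=> c) = c.
Proof. by rewrite /expect -mulr_suml mu1 mul1r. Qed.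

Lemma expect_sqrB f c :
  expect (fun s => (f s - c) ^+ 2) =
  expect (fun s => f s ^+ 2) - 2 * c * expect f + c ^+ 2.
Proof.
rewrite (eq_expect (g := fun s => f s ^+ 2 + (- (2 * c) * f s + c ^+ 2))).
  by rewrite !expectD expectZ expect_cst; ring.
by move=> s; ring.
Qed.

Lemma varianceE f : variance f = expect (fun s => f s ^+ 2) - expect f ^+ 2.
Proof. by rewrite /variance expect_sqrB; ring. Qed.

Lemma variance_ge0 f : 0 <= variance f.
Proof. by apply: expect_ge0 => s; apply: sqr_ge0. Qed.

Lemma expect_sqr_le f : expect f ^+ 2 <= expect (fun s => f s ^+ 2).
Proof. by rewrite -subr_ge0 -varianceE variance_ge0. Qed.

(** The form suited to canonical paths, each of which joins two independent samples of [mu]. *)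
Lemma variance_pairs f :
  \sum_s \sum_s' mu s * mu s' * (f s' - f s) ^+ 2 = 2 * variance f.
Proof.
transitivity (expect (fun s => expect (fun s' => (f s' - f s) ^+ 2))).
  apply: eq_bigr => s _; rewrite mulr_sumr; apply: eq_bigr => s' _.
  by rewrite mulrA.
rewrite (eq_expect (fun s => expect_sqrB f (f s))) varianceE.
rewrite (eq_expect (g := fun s => expect (fun s => f s ^+ 2) +
           (- (2 * expect f) * f s + f s ^+ 2))); last by move=> s; ring.
by rewrite !expectD expectZ expect_cst; ring.
Qed.

End Expectation.

Section Chain.
Variables (R : realType) (Omega : finType) (P : Omega -> Omega -> R).
Implicit Types (f g : Omega -> R).

Definition chain_op f (s : Omega) : R := expect (P s) f.

(** Removes matrices and the enumeration of states: from here on only iterates of [chain_op] on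
    observables occur. *)
Lemma nstep_iter t f s :
  expect (nstep P t s) f = iter t chain_op f s.
Proof.
elim: t s => [|t IHt] s.
  rewrite /expect /nstep expr0 (bigD1 s)//= mxE eqxx mul1r big1 ?addr0// => s'.
  rewrite mxE (inj_eq enum_rank_inj) eq_sym => /negPf ->.
  by rewrite mul0r.
rewrite iterS /= /chain_op /expect.
under eq_bigr => s' _.
  rewrite /nstep exprS mxE (reindex_onto (@enum_rank Omega) enum_val)/=; last first.
    by move=> i _; rewrite enum_valK.
  under eq_bigl => i do rewrite enum_rankK eqxx.
  under eq_bigr => i _ do rewrite mxE !enum_rankK.
  rewrite mulr_suml; over.
rewrite exchange_big; apply: eq_bigr => s' _.
rewrite -IHt /expect mulr_sumr; apply: eq_bigr => s'' _.
by rewrite mulrA.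
Qed.

Definition indic (A : {set Omega}) (s : Omega) : R := (s \in A)%:R.

Lemma expect_indic (nu : Omega -> R) (A : {set Omega}) :
  expect nu (indic A) = \sum_(s in A) nu s.
Proof.
rewrite [RHS]big_mkcond; apply: eq_bigr => s _; rewrite /indic.
by case: ifP; rewrite ?mulr1 ?mulr0.
Qed.

Lemma indic_ge0 A s : 0 <= indic A s. Proof. exact: ler0n. Qed.

Lemma indic_le1 A s : indic A s <= 1. Proof. by rewrite lern1 leq_b1. Qed.

Lemma mixing_time_le (mu : Omega -> R) t : is_mixed P mu t ->
  (mixing_time P mu <= t%:R%:E)%E.
Proof.
move=> mixt; rewrite /mixing_time; case: pselect => [ex_t|[]]; last by exists t.
by rewrite lee_fin ler_nat; case: ex_minnP => m _; apply.
Qed.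

(** The bound [1 + x <= expR x] at [x = -1/2] gives [expR (1/2) <= 2], hence [expR 1 <= 4]; a
    rational threshold can then replace [1 / (2e)]. *)
Lemma eight_le_2e : 8^-1 <= (2 * expR 1)^-1 :> R.
Proof.
have e0 : 0 < expR 1 :> R := expR_gt0 _.
rewrite lef_pV2 ?posrE ?mulr_gt0//.
suff : expR 1 <= 4 :> R by lra.
have h : 2^-1 <= expR (- 2^-1) :> R.
  by apply: le_trans (expR_ge1Dx _); lra.
have h0 : 0 < expR 2^-1 :> R := expR_gt0 _.
have hh : expR 2^-1 <= 2 :> R.
  by rewrite -[leRHS]invrK -[leLHS]invrK lef_pV2 ?posrE ?invr_gt0// -expRN.
have -> : expR 1 = expR 2^-1 * expR 2^-1 :> R by rewrite -expRD; congr expR; lra.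
nra.
Qed.

Lemma mixing_time_le8 (mu : Omega -> R) t :
  (forall s A, `|expect mu (indic A) - iter t chain_op (indic A) s| <= 8^-1) ->
  (mixing_time P mu <= t%:R%:E)%E.
Proof.
move=> h; apply: mixing_time_le; rewrite /is_mixed.
apply: le_trans eight_le_2e.
apply: bigmax_le => [|s _]; first by rewrite invr_ge0.
apply: bigmax_le => [|A _]; first by rewrite invr_ge0.
by rewrite -!expect_indic nstep_iter.
Qed.

Section Contraction.
Variables (mu : Omega -> R) (gamma : R).
Hypothesis mu_gt0 : forall s, 0 < mu s.
Hypothesis mu1 : \sum_s mu s = 1.
Hypothesis stationary : forall f, expect mu (chain_op f) = expect mu f.

Lemma expect_iter t f : expect mu (iter t chain_op f) = expect mu f.
Proof. by elim: t => [//|t IHt]; rewrite iterS stationary. Qed.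

Hypothesis positive : forall f,
  expect mu (fun s => chain_op f s ^+ 2) <= expect mu (fun s => f s * chain_op f s).
Hypothesis poincare : forall f, gamma * variance mu f <=
  expect mu (fun s => f s ^+ 2) - expect mu (fun s => f s * chain_op f s).
Hypothesis gamma_le1 : gamma <= 1.

Let mu_ge0 s : 0 <= mu s. Proof. exact: ltW. Qed.

(** Positivity says that the square of the operator is dominated by the operator itself, so no
    eigenvalue near -1 can spoil the decay and the Poincare inequality alone suffices. *)
Lemma variance_chain_op f :
  variance mu (chain_op f) <= (1 - gamma) * variance mu f.
Proof.
rewrite !varianceE// stationary.
have := poincare f; have := positive f; rewrite varianceE//; lra.
Qed.

Lemma variance_iter t f :
  variance mu (iter t chain_op f) <= (1 - gamma) ^+ t * variance mu f.
Proof.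
elim: t => [|t IHt]; first by rewrite expr0 mul1r.
rewrite iterS (le_trans (variance_chain_op _))// exprS -mulrA.
by rewrite ler_wpM2l// subr_ge0.
Qed.

(** An indicator has variance at most 1, so after [t] steps the variance is at most [m / 64]. A
    single state carries mass at least [m], so the squared deviation there is at most [1/64], the
    square of [1/8]. *)
Lemma mixing_time_poincare (m : R) t : 0 < m -> (forall s, m <= mu s) ->
  (1 - gamma) ^+ t <= m / 64 -> (mixing_time P mu <= t%:R%:E)%E.
Proof.
move=> m0 m_le gt; apply: mixing_time_le8 => s A.
set f := indic A; set x := _ - _.
have xE : x ^+ 2 = (iter t chain_op f s - expect mu (iter t chain_op f)) ^+ 2.
  by rewrite expect_iter -sqrrN opprB.
have V1 : variance mu f <= 1.
  rewrite varianceE//.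
  have : expect mu (fun s => f s ^+ 2) <= 1.
    rewrite -[leRHS](expect_cst mu1); apply: ler_expect => // s'.
    by rewrite expr_le1// ?indic_le1 ?indic_ge0.
  have := sqr_ge0 (expect mu f); lra.
have h1 : m * x ^+ 2 <= m / 64.
  apply: le_trans (_ : mu s * x ^+ 2 <= _).
    by rewrite ler_wpM2r// sqr_ge0.
  rewrite xE; apply: le_trans gt.
  apply: le_trans (_ : variance mu (iter t chain_op f) <= _).
    by apply: (ler_expect_at mu_ge0 s
      (f := fun s => (iter t chain_op f s - expect mu (iter t chain_op f)) ^+ 2)) => s';
      apply: sqr_ge0.
  apply: le_trans (variance_iter _ _) _.
  by rewrite ler_piMr// exprn_ge0// subr_ge0.
have h2 : x ^+ 2 <= 8^-1 ^+ 2.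
  rewrite -(ler_pM2l m0); lra.
have e0 : 0 <= 8^-1 :> R by lra.
by rewrite -ler_sqr ?nnegrE// real_normK// num_real.
Qed.

End Contraction.
End Chain.

(** * Canonical paths for the Gibbs measure *)

(** Cauchy-Schwarz, read off from [expect_sqr_le] for the uniform law on [I]. *)
Lemma sqr_sum_le (R : realFieldType) (I : finType) (F : I -> R) :
  (\sum_i F i) ^+ 2 <= #|I|%:R * \sum_i F i ^+ 2.
Proof.
have [I0|I_gt0] := posnP #|I|.
  by rewrite !big_pred0 ?I0 ?expr0n ?mul0r// => i; move/card0_eq: I0 => /(_ i).
have n0 : 0 < #|I|%:R :> R by rewrite ltr0n.
have u1 : \sum_(i : I) #|I|%:R^-1 = 1 :> R.
  by rewrite sumr_const -[_ *+ _]mulr_natl divff// gt_eqF.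
have u0 (i : I) : 0 <= #|I|%:R^-1 :> R by rewrite invr_ge0 ler0n.
have := expect_sqr_le u0 u1 F; rewrite /expect -!mulr_sumr.
set S := \sum_i F i; set T := \sum_i _ => h.
have -> : S ^+ 2 = #|I|%:R ^+ 2 * (#|I|%:R^-1 * S) ^+ 2 by field; rewrite gt_eqF.
have -> : #|I|%:R * T = #|I|%:R ^+ 2 * (#|I|%:R^-1 * T) by field; rewrite gt_eqF.
by rewrite ler_wpM2l// sqr_ge0.
Qed.

Section Gibbs.
Variables (R : realType) (V : finType) (E : {set {set V}}).
Variables (q : nat) (beta : R).
Hypothesis q_gt0 : (0 < q)%N.
Hypothesis beta_ge0 : 0 <= beta.

Local Notation config := (spin_config V q).
Local Notation mu := (@gibbs R V E q beta).
Implicit Types (s t : config) (f : config -> R) (v : V) (k : 'I_q).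

Let qR_gt0 : 0 < q%:R :> R. Proof. by rewrite ltr0n. Qed.

Lemma sum_uniform_spin : \sum_(k : 'I_q) q%:R^-1 = 1 :> R.
Proof.
by rewrite sumr_const card_ord -[_ *+ _]mulr_natl divff// gt_eqF.
Qed.

Lemma potts_weight_gt0 s : 0 < potts_weight E beta s.
Proof. exact: expR_gt0. Qed.

Lemma partition_gt0 : 0 < \sum_(s : config) potts_weight E beta s.
Proof.
rewrite (bigD1 [ffun=> Ordinal q_gt0])//=.
rewrite ltr_pwDl ?potts_weight_gt0//.
by apply: sumr_ge0 => s _; rewrite ltW// potts_weight_gt0.
Qed.

Lemma gibbs_gt0 s : 0 < mu s.
Proof. by rewrite divr_gt0 ?potts_weight_gt0// partition_gt0. Qed.

Lemma gibbs_ge0 s : 0 <= mu s.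
Proof. exact/ltW/gibbs_gt0. Qed.

Lemma sum_gibbs : \sum_s mu s = 1.
Proof. by rewrite -mulr_suml divff// gt_eqF// partition_gt0. Qed.

Lemma monochromatic2 s x y : monochromatic s [set x; y] = (s x == s y).
Proof.
apply/idP/eqP => [/forall_inP/(_ x)|sxy].
  by rewrite set21 => /(_ isT)/forall_inP/(_ y); rewrite set22 => /(_ isT)/eqP.
apply/forall_inP => z /set2P zxy; apply/forall_inP => z' /set2P z'xy.
by case: zxy => ->; case: z'xy => ->; rewrite ?sxy.
Qed.

Lemma eq_monochromatic s t (e : {set V}) :
  {in e, s =1 t} -> monochromatic s e = monochromatic t e.
Proof.
move=> st; apply: eq_forallb_in => x xe; apply: eq_forallb_in => y ye.
by rewrite !st.
Qed.

Lemma energy_ge0 s : 0 <= potts_energy R E s.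
Proof. by apply: sumr_ge0 => e _; rewrite subr_ge0 lern1 leq_b1. Qed.

Lemma energy_le s : potts_energy R E s <= #|E|%:R.
Proof.
rewrite -sum1_card natr_sum; apply: ler_sum => e _.
by rewrite lerBlDr lerDl ler0n.
Qed.

(** Every weight lies between [expR (- beta * #|E|)] and 1, so the partition function is at most the
    number of configurations. *)
Lemma gibbs_ge s : expR (- beta * #|E|%:R) / q%:R ^+ #|V| <= mu s.
Proof.
apply: ler_pM; rewrite ?expR_ge0 ?invr_ge0 ?exprn_ge0 ?ler0n//.
  by rewrite ler_expR !mulNr lerN2 ler_wpM2l// energy_le.
rewrite lef_pV2 ?posrE ?partition_gt0 ?exprn_gt0//.
apply: le_trans (_ : \sum_(s' : config) 1 <= _).
  apply: ler_sum => s' _.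
  by rewrite expR_le1 mulNr oppr_le0 mulr_ge0 ?energy_ge0.
by rewrite sumr_const card_ffun card_ord natrX.
Qed.

Lemma expect_gibbs_perm (pi : {perm 'I_q}) f :
  expect mu (fun s => f [ffun x => pi (s x)]) = expect mu f.
Proof.
pose act (pi : {perm 'I_q}) s : config := [ffun x => pi (s x)].
have actK : cancel (act pi) (act pi^-1%g).
  by move=> s; apply/ffunP => x; rewrite !ffunE permK.
have actVK : cancel (act pi^-1%g) (act pi).
  by move=> s; apply/ffunP => x; rewrite !ffunE permKV.
rewrite /expect [RHS](reindex (act pi)); last by exists (act pi^-1%g) => s _.
apply: eq_bigr => s _; congr (_ / _ * _); congr expR; congr (_ * _).
apply: eq_bigr => e _; congr (1 - _%:R); congr nat_of_bool.
apply: eq_forallb_in => x _; apply: eq_forallb_in => y _.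
by rewrite !ffunE (inj_eq perm_inj).
Qed.

(** The transposition of [k] and [l] equates the masses of the two colours at [v], and the [q]
    masses add up to 1. *)
Lemma expect_gibbs_spin v (h : 'I_q -> R) :
  expect mu (fun s => h (s v)) = q%:R^-1 * \sum_k h k.
Proof.
pose m k := expect mu (fun s => (s v == k)%:R).
have mE k l : m k = m l.
  rewrite -[LHS](expect_gibbs_perm (tperm k l)); apply: eq_expect => s.
  by rewrite ffunE -(inj_eq (@perm_inj _ (tperm k l))) tpermK tpermL.
have sum_m : \sum_k m k = 1.
  rewrite -expect_sum -[RHS](expect_cst sum_gibbs 1); apply: eq_expect => s.
  rewrite (bigD1 (s v))//= eqxx big1 ?addr0// => k.
  by rewrite eq_sym => /negPf ->.
have mq k : m k = q%:R^-1.
  have : q%:R * m k = 1.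
    rewrite -[RHS]sum_m [RHS](eq_bigr (fun=> m k)) => [|l _]; last exact: mE.
    by rewrite sumr_const card_ord mulr_natl.
  by move=> h1; apply: (mulfI (x := q%:R)); rewrite ?h1 ?divff// gt_eqF.
rewrite mulr_sumr.
transitivity (\sum_k expect mu (fun s => h k * (s v == k)%:R)).
  rewrite -expect_sum; apply: eq_expect => s.
  rewrite (bigD1 (s v))//= eqxx mulr1 big1 ?addr0// => k.
  by rewrite eq_sym => /negPf ->; rewrite mulr0.
by apply: eq_bigr => k _; rewrite expectZ -/(m k) mq mulrC.
Qed.

(** The form through which both chains are compared with the canonical paths: the new spin is
    uniform whatever the neighbouring spins are. *)
Definition site_form v f : R :=
  expect mu (fun s => q%:R^-1 * \sum_k (f (set_spin s v k) - f s) ^+ 2).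

Section CanonicalPaths.
Variables (r : V -> nat) (w : nat).
Hypothesis r_inj : injective r.
Hypothesis r_lt : forall v, (r v < #|V|)%N.

Definition cut_edges (i : nat) : {set {set V}} :=
  [set e in E | [exists x in e, r x < i] && [exists y in e, i <= r y]]%N.

Hypothesis cut_le : forall i, (#|cut_edges i| <= w)%N.

(** The point reached after [i] flips on the path from [s] to [t]. Together with [mix i t s] it
    still determines both endpoints, by [mixK]. *)
Definition mix i s t : config := [ffun x => if (r x < i)%N then t x else s x].

Lemma mixK i s t : mix i (mix i s t) (mix i t s) = s.
Proof. by apply/ffunP => x; rewrite !ffunE; case: (_ < _)%N. Qed.

Lemma mix0 s t : mix 0 s t = s.
Proof. by apply/ffunP => x; rewrite ffunE. Qed.

Lemma mix_card s t : mix #|V| s t = t.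
Proof. by apply/ffunP => x; rewrite ffunE r_lt. Qed.

(** The new spin is just [t v]; written as a spin of the complementary configuration, it becomes the
    spin of an independent sample once the segments are exchanged. *)
Lemma mix_succ v s t :
  mix (r v).+1 s t = set_spin (mix (r v) s t) v (mix (r v) t s v).
Proof.
apply/ffunP => x; rewrite !ffunE ltnn ltnS leq_eqVlt (inj_eq r_inj).
by case: eqVneq => [->|].
Qed.

(** An edge on one side of the cut sees its two contributions merely exchanged or unchanged, and a
    cut edge contributes at most 2 on the left. *)
Lemma mix_energy i s t :
  potts_energy R E (mix i s t) + potts_energy R E (mix i t s)
  <= potts_energy R E s + potts_energy R E t + 2 * w%:R.
Proof.
apply: le_trans (_ : _ <= potts_energy R E s + potts_energy R E t +
  2 * \sum_(e in E) (e \in cut_edges i)%:R) _; last first.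
  rewrite lerD2l ler_wpM2l// -natr_sum ler_nat (leq_trans _ (cut_le i))//.
  rewrite -sum1_card [leqLHS]big_mkcond [leqRHS]big_mkcond leq_sum// => e _.
  by case: ifP => //; case: (_ \in cut_edges i).
rewrite mulr_sumr -!big_split; apply: ler_sum => e eE; rewrite /= inE eE /=.
set A := [exists x in e, _]; set B := [exists x in e, _].
have bool01 (b : bool) : 0 <= (b%:R : R) <= 1 by rewrite ler0n lern1 leq_b1.
case: (boolP A) => [_|/exists_inPn A0].
  case: (boolP B) => [_|/exists_inPn B0] /=.
    have := bool01 (monochromatic s e); have := bool01 (monochromatic t e).
    have := bool01 (monochromatic (mix i s t) e).
    have := bool01 (monochromatic (mix i t s) e); lra.
  rewrite (@eq_monochromatic (mix i s t) t) ?(@eq_monochromatic (mix i t s) s).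
  - lra.
  - by move=> x xe; rewrite ffunE ltnNge B0.
  - by move=> x xe; rewrite ffunE ltnNge B0.
rewrite (@eq_monochromatic (mix i s t) s) ?(@eq_monochromatic (mix i t s) t).
- by rewrite mulr0 addr0.
- by move=> x xe; rewrite ffunE (negPf (A0 _ xe)).
- by move=> x xe; rewrite ffunE (negPf (A0 _ xe)).
Qed.

Lemma mix_gibbs i s t :
  mu s * mu t <= expR (2 * beta * w%:R) * (mu (mix i s t) * mu (mix i t s)).
Proof.
rewrite /gibbs !mulf_div mulrA.
rewrite ler_wpM2r ?invr_ge0 ?mulr_ge0 ?(ltW partition_gt0)//.
rewrite -!expRD ler_expR.
have := ler_wpM2l beta_ge0 (mix_energy i s t); lra.
Qed.

Lemma mix_telescope f s t :
  f t - f s = \sum_v (f (mix (r v).+1 s t) - f (mix (r v) s t)).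
Proof.
pose r' v := Ordinal (r_lt v).
have r'_inj : injective r' by move=> x y /(congr1 val) /r_inj.
have r'_bij : bijective r' by apply: inj_card_bij => //; rewrite card_ord.
rewrite -{1}(mix_card s t) -{2}(mix0 s t).
rewrite -(telescope_sumr (fun i => f (mix i s t))) // big_mkord.
by rewrite (reindex r'); last exact: onW_bij.
Qed.

Lemma canonical_path_bound v f :
  \sum_s \sum_t mu s * mu t * (f (mix (r v).+1 s t) - f (mix (r v) s t)) ^+ 2
  <= expR (2 * beta * w%:R) * site_form v f.
Proof.
pose F s t := mu s * mu t * (f (set_spin s v (t v)) - f s) ^+ 2.
apply: le_trans (_ : expR (2 * beta * w%:R) *
    \sum_s \sum_t F (mix (r v) s t) (mix (r v) t s) <= _).
  rewrite mulr_sumr; apply: ler_sum => s _.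
  rewrite mulr_sumr; apply: ler_sum => t _.
  by rewrite /F mulrA mix_succ ler_wpM2r ?sqr_ge0// mix_gibbs.
rewrite ler_wpM2l ?expR_ge0// pair_big /=.
(* Reindexing by this involution makes the intermediate configuration and its complement two
   independent samples. *)
pose swap (p : config * config) := (mix (r v) p.1 p.2, mix (r v) p.2 p.1).
have swapK : involutive swap by move=> [s t]; rewrite /swap /= !mixK.
rewrite (reindex swap)/=; last by apply: onW_bij; apply: inv_bij.
rewrite (eq_bigr (fun p => F p.1 p.2)); last by move=> p _; rewrite !mixK.
rewrite -(pair_big xpredT xpredT F)/=; apply: ler_sum => s _.
(* The second sample now enters only through its spin at [v], which is uniform. *)
rewrite -(expect_gibbs_spin v (fun k => (f (set_spin s v k) - f s) ^+ 2)).
by rewrite /F mulr_sumr; apply: ler_sum => t _; rewrite mulrA.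
Qed.

Lemma variance_le_site_forms f :
  2 * variance mu f
  <= #|V|%:R * expR (2 * beta * w%:R) * \sum_v site_form v f.
Proof.
rewrite -(variance_pairs sum_gibbs) -mulrA [X in _ * X]mulr_sumr.
apply: le_trans (_ : \sum_s \sum_t \sum_v #|V|%:R * (mu s * mu t *
   (f (mix (r v).+1 s t) - f (mix (r v) s t)) ^+ 2) <= _).
  apply: ler_sum => s _; apply: ler_sum => t _.
  rewrite -!mulr_sumr [leRHS]mulrCA ler_wpM2l//; first by apply: mulr_ge0; apply: gibbs_ge0.
  by rewrite mix_telescope sqr_sum_le.
under eq_bigr => s _ do rewrite exchange_big.
rewrite exchange_big mulr_sumr; apply: ler_sum => v _ /=.
under eq_bigr => s _ do rewrite -mulr_sumr.
by rewrite -mulr_sumr ler_wpM2l ?ler0n// canonical_path_bound.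
Qed.

Hypothesis V_gt0 : (0 < #|V|)%N.

(** Shared end of both gap proofs: [X] is the Dirichlet form of the chain and [a] the cost of
    comparing its update of a site with uniform resampling. One factor [#|V|] comes from
    Cauchy-Schwarz along the path, the other from the scaling of [X] in the hypothesis. *)
Lemma poincare_of_site_forms a X f : 0 < a ->
  a * \sum_v site_form v f <= 2 * (#|V|%:R * X) ->
  a * expR (- (2 * beta * w%:R)) / #|V|%:R ^+ 2 * variance mu f <= X.
Proof.
move=> a0; have := variance_le_site_forms f; rewrite expRN.
move: (\sum_v _) (expR (2 * _ * _)) (expR_gt0 (2 * beta * w%:R)) => T B B0.
have : 0 < #|V|%:R :> R by rewrite ltr0n.
set n := #|V|%:R => n0 VT aT.
have -> : a / B / n ^+ 2 * variance mu f = a * variance mu f / (B * n ^+ 2).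
  by field; rewrite !gt_eqF.
rewrite ler_pdivrMr ?mulr_gt0 ?exprn_gt0//.
suff : 2 * (a * variance mu f) <= 2 * (X * (B * n ^+ 2)) by rewrite ler_pM2l.
rewrite mulrCA (le_trans (ler_wpM2l (ltW a0) VT))//.
rewrite (_ : a * _ = n * B * (a * T)); last by ring.
rewrite (_ : 2 * _ = n * B * (2 * (n * X))); last by ring.
by rewrite ler_wpM2l// mulr_ge0// ltW.
Qed.

End CanonicalPaths.
End Gibbs.

(** * Heat bath chain: spectral gap *)

Section Recolour.
Variables (R : realType) (V : finType) (q : nat).
Local Notation config := (spin_config V q).
Implicit Types (s : config) (v : V) (k : 'I_q).

Definition set_block s (C : {set V}) k : config :=
  [ffun x => if x \in C then k else s x].

Lemma set_spinE s v k : set_spin s v k = set_block s [set v] k.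
Proof. by apply/ffunP => x; rewrite !ffunE inE. Qed.

Lemma set_spin_spin s v k l : set_spin (set_spin s v k) v l = set_spin s v l.
Proof. by apply/ffunP => x; rewrite !ffunE; case: eqP. Qed.

Lemma set_spin_id s v : set_spin s v (s v) = s.
Proof. by apply/ffunP => x; rewrite !ffunE; case: eqP => [->|]. Qed.

(** Exchanging the common spin on [C] with the proposed one is an involution on pairs. It yields
    reversibility of the heat bath updates for [C = [set v]] and invariance under recolouring a
    component. *)
Lemma sum_set_block (C : {set V}) v (Q : pred config) (F : config -> 'I_q -> R) :
  v \in C -> (forall s k, Q s -> Q (set_block s C k)) ->
  (forall s, Q s -> {in C, forall x, s x = s v}) ->
  \sum_(s | Q s) \sum_k F s k = \sum_(s | Q s) \sum_k F (set_block s C k) (s v).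
Proof.
move=> vC QC constC; pose h (p : config * 'I_q) := (set_block p.1 C p.2, p.1 v).
rewrite !pair_big_dep /= (reindex_onto h h)/=; last first.
  move=> [s k] /andP[/= Qs _]; rewrite /h /=; congr pair; last by rewrite ffunE vC.
  apply/ffunP => x; rewrite !ffunE; case xC: (x \in C) => //.
  by rewrite (constC _ Qs _ xC).
apply: eq_bigl => -[s k]; rewrite /h /= !andbT; apply/andP/idP => [[]|Qs].
  by move=> Qs' /eqP[<- _]; apply: QC.
split; first exact: QC.
rewrite xpair_eqE ffunE vC eqxx andbT; apply/eqP/ffunP => x; rewrite !ffunE.
by case xC: (x \in C) => //; rewrite (constC _ Qs _ xC).
Qed.

Lemma sum_set_spin v (F : config -> 'I_q -> R) :
  \sum_s \sum_k F s k = \sum_s \sum_k F (set_spin s v k) (s v).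
Proof.
rewrite (@sum_set_block [set v] v xpredT) ?set11//.
  by apply: eq_bigr => s _; apply: eq_bigr => k _; rewrite set_spinE.
by move=> s _ x /set1P ->.
Qed.

End Recolour.

(** * Degrees and number of edges from the cut width *)

Section Degree.
Variables (V : finType) (E : {set {set V}}).
Hypothesis E2 : forall e, e \in E -> #|e| = 2.

Definition star (v : V) : {set {set V}} := [set e in E | v \in e].

(** Links the energy, a sum over edges, with the local weights, sums over neighbours. *)
Lemma star_imset v : star v = [set [set v; x] | x in [set x | [set v; x] \in E]].
Proof.
apply/setP => e; rewrite inE; apply/andP/imsetP => [[eE ve]|[x]].
  have /cards2P[x [y [xy exy]]] : #|e| == 2 by rewrite E2.
  move: ve; rewrite exy => /set2P[vx|vy].
    by exists y; rewrite ?inE vx -?exy.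
  by exists x; rewrite ?inE vy setUC -?exy.
by rewrite inE => eE ->; rewrite eE set21.
Qed.

Lemma edge_neq v x : [set v; x] \in E -> x != v.
Proof.
by move=> /E2; rewrite cards2 eq_sym; case: eqP.
Qed.

Lemma star_inj v : {in [set x | [set v; x] \in E] &, injective (fun x => [set v; x])}.
Proof.
move=> x y; rewrite !inE => /edge_neq xv _ /setP /(_ x).
by rewrite set22 !inE (negPf xv) => /esym/eqP.
Qed.

Lemma card_star v : #|star v| = #|[pred x | [set v; x] \in E]|.
Proof.
rewrite star_imset card_in_imset; last exact: star_inj.
by apply: eq_card => x; rewrite !inE.
Qed.

Lemma sum_star (R : nmodType) v (F : {set V} -> R) :
  \sum_(e in star v) F e = \sum_(x | [set v; x] \in E) F [set v; x].
Proof.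
rewrite star_imset big_imset /=; last exact: star_inj.
by apply: eq_bigl => x; rewrite inE.
Qed.

Variables (r : V -> nat) (w : nat).
Hypothesis r_inj : injective r.
Hypothesis cut_le : forall i, (#|cut_edges E r i| <= w)%N.

(** An edge at [v] is cut at level [r v] if its other end comes earlier, and at level [(r v).+1] if
    it comes later. *)
Lemma card_star_le v : (#|star v| <= 2 * w)%N.
Proof.
rewrite mul2n -addnn.
apply: leq_trans (leq_add (cut_le (r v)) (cut_le (r v).+1)).
apply: leq_trans (leq_card_setU _ _); apply: subset_leq_card.
rewrite star_imset; apply/subsetP => _ /imsetP[x + ->].
rewrite !inE => vxE; rewrite vxE /=.
have xv := edge_neq vxE.
case: (ltngtP (r x) (r v)) => [lt_xv|lt_vx|/r_inj/eqP]; last by rewrite (negPf xv).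
  apply/orP; left; apply/andP; split; apply/exists_inP.
    by exists x => //; rewrite set22.
  by exists v => //; rewrite set21.
apply/orP; right; apply/andP; split; apply/exists_inP.
  by exists v => //; rewrite set21.
by exists x => //; rewrite set22.
Qed.

Lemma card_edges_le : (#|E| <= #|V| * (2 * w))%N.
Proof.
apply: leq_trans (_ : \sum_(v : V) #|star v| <= _)%N; last first.
  by rewrite -sum_nat_const leq_sum// => v _; exact: card_star_le.
apply: leq_trans (_ : #|\bigcup_(v : V) star v| <= _)%N; last first.
  elim/big_rec2: _ => [|v m C _ IH]; first by rewrite cards0.
  by apply: leq_trans (leq_card_setU _ _) _; rewrite leq_add2l.
apply/subset_leq_card/subsetP => e eE; apply/bigcupP.
have /cards2P[x [y [_ exy]]] : #|e| == 2 by rewrite E2.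
by exists x => //; rewrite inE eE exy set21.
Qed.

End Degree.

(** * Single-site heat bath updates as projections *)

Section HeatBath.
Variables (R : realType) (V : finType) (E : {set {set V}}).
Variables (q : nat) (beta : R).
Hypothesis q_gt0 : (0 < q)%N.
Hypothesis beta_ge0 : 0 <= beta.
Hypothesis E2 : forall e, e \in E -> #|e| = 2.
Hypothesis V_gt0 : (0 < #|V|)%N.
Variable D : nat.
Hypothesis degree_le : forall v, (#|star E v| <= D)%N.

Local Notation config := (spin_config V q).
Local Notation mu := (@gibbs R V E q beta).
Local Notation W := (local_weight E beta).
Implicit Types (s t : config) (f g : config -> R) (v : V) (k l : 'I_q).

Let qR_gt0 : 0 < q%:R :> R. Proof. by rewrite ltr0n. Qed.
Let n_gt0 : 0 < #|V|%:R :> R. Proof. by rewrite ltr0n. Qed.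

Lemma local_weight_ge1 s v k : 1 <= W s v k.
Proof.
by rewrite /local_weight -[leLHS]expR0 ler_expR mulr_ge0// sumr_ge0.
Qed.

Lemma local_weight_gt0 s v k : 0 < W s v k.
Proof. exact: expR_gt0. Qed.

Lemma local_weight_le s v k : W s v k <= expR (beta * D%:R).
Proof.
rewrite ler_expR ler_wpM2l//.
apply: le_trans (_ : \sum_(x | [set v; x] \in E) 1 <= _).
  by apply: ler_sum => x _; rewrite lern1 leq_b1.
by rewrite sumr_const -card_star// ler_nat.
Qed.

Lemma local_weight_sum_ge s v : q%:R <= \sum_l W s v l.
Proof.
apply: le_trans (_ : \sum_(l : 'I_q) 1 <= _); first by rewrite sumr_const card_ord.
by apply: ler_sum => l _; apply: local_weight_ge1.
Qed.

Lemma local_weight_sum_gt0 s v : 0 < \sum_l W s v l.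
Proof. exact: lt_le_trans (local_weight_sum_ge s v). Qed.

Lemma local_weight_sum_le s v : \sum_l W s v l <= q%:R * expR (beta * D%:R).
Proof.
apply: le_trans (_ : \sum_(l : 'I_q) expR (beta * D%:R) <= _).
  by apply: ler_sum => l _; apply: local_weight_le.
by rewrite sumr_const card_ord mulr_natl.
Qed.

Definition local_prob v s k : R := W s v k / \sum_l W s v l.

Lemma local_prob_ge0 v s k : 0 <= local_prob v s k.
Proof. by rewrite divr_ge0// ltW// ?local_weight_gt0 ?local_weight_sum_gt0. Qed.

Lemma sum_local_prob v s : \sum_k local_prob v s k = 1.
Proof. by rewrite -mulr_suml divff// gt_eqF// local_weight_sum_gt0. Qed.

(** The comparison with uniform resampling: the weight is at least 1, and the normalisation is at
    most [q * expR (beta * D)]. *)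
Lemma local_prob_ge v s k : expR (- (beta * D%:R)) / q%:R <= local_prob v s k.
Proof.
rewrite expRN -invfM mulrC -[leLHS]mul1r; apply: ler_pM => //.
- by rewrite invr_ge0 mulr_ge0 ?expR_ge0// ltW.
- exact: local_weight_ge1.
- rewrite lef_pV2 ?posrE ?local_weight_sum_gt0 ?mulr_gt0 ?expR_gt0//.
  exact: local_weight_sum_le.
Qed.

Lemma local_weight_set_spin s v k l : W (set_spin s v k) v l = W s v l.
Proof.
congr (expR (_ * _)); apply: eq_bigr => x /(edge_neq E2)/negPf xv.
by rewrite ffunE xv.
Qed.

Lemma local_prob_set_spin s v k l : local_prob v (set_spin s v k) l = local_prob v s l.
Proof.
rewrite /local_prob local_weight_set_spin; congr (_ / _).
by apply: eq_bigr => i _; rewrite local_weight_set_spin.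
Qed.

(** The energy counts disagreements and the local weights count agreements; the constant
    [#|star E v|] between them cancels in ratios. *)
Lemma energy_local s v : potts_energy R E s =
  \sum_(e in E | v \notin e) (1 - (monochromatic s e)%:R)
  + #|star E v|%:R - \sum_(x | [set v; x] \in E) (s v == s x)%:R.
Proof.
rewrite /potts_energy (bigID (fun e : {set V} => v \in e))/= addrC -addrA; congr (_ + _).
rewrite (eq_bigl (mem (star E v))) => [|e]; last by rewrite !inE.
rewrite sum_star// sumrB sumr_const card_star//; congr (_ - _).
by apply: eq_bigr => x _; rewrite monochromatic2.
Qed.

Lemma gibbs_local s v k :
  mu (set_spin s v k) * W s v (s v) = mu s * W s v k.
Proof.
rewrite /gibbs -!mulrA ![_^-1 * _]mulrC !mulrA; congr (_ / _).
rewrite -!expRD; congr expR; rewrite !(energy_local _ v).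
rewrite (eq_bigr (fun e => 1 - (monochromatic s e)%:R)) => [|e /andP[_ ve]].
  rewrite (eq_bigr (fun x => (k == s x)%:R)) => [|x /(edge_neq E2)/negPf xv].
    ring.
  by rewrite !ffunE eqxx xv.
rewrite (@eq_monochromatic _ _ _ s)// => x xe; rewrite ffunE.
by case: eqP => // xv; rewrite -xv xe in ve.
Qed.

Lemma local_detailed_balance s v k :
  mu s * local_prob v s k =
  mu (set_spin s v k) * local_prob v (set_spin s v k) (s v).
Proof.
by rewrite local_prob_set_spin /local_prob !mulrA gibbs_local.
Qed.

Definition heat_bath_at v f s : R := \sum_k local_prob v s k * f (set_spin s v k).

(** Detailed balance in two-variable form: at equilibrium the joint law of the old and the new
    configuration is symmetric. *)
Lemma heat_bath_exchange v (F : config -> config -> R) :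
  expect mu (fun s => \sum_k local_prob v s k * F s (set_spin s v k)) =
  expect mu (fun s => \sum_k local_prob v s k * F (set_spin s v k) s).
Proof.
rewrite /expect; under eq_bigr => s _ do rewrite mulr_sumr.
rewrite (sum_set_spin v); apply: eq_bigr => s _.
rewrite mulr_sumr; apply: eq_bigr => k _.
by rewrite set_spin_spin set_spin_id mulrA [RHS]mulrA (local_detailed_balance s).
Qed.

Lemma expect_heat_bath_at v f : expect mu (heat_bath_at v f) = expect mu f.
Proof.
rewrite (heat_bath_exchange v (fun=> f)); apply: eq_expect => s.
by rewrite -mulr_suml sum_local_prob mul1r.
Qed.

Lemma heat_bath_at_set_spin v f s k :
  heat_bath_at v f (set_spin s v k) = heat_bath_at v f s.
Proof.
apply: eq_bigr => l _; rewrite set_spin_spin.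
by rewrite local_prob_set_spin.
Qed.

(** The update at [v] is an orthogonal projection: it is self-adjoint, and its output does not
    depend on the spin at [v]. *)
Lemma expect_heat_bath_at_sqr v f :
  expect mu (fun s => heat_bath_at v f s ^+ 2) =
  expect mu (fun s => f s * heat_bath_at v f s).
Proof.
transitivity (expect mu (fun s => \sum_k local_prob v s k *
    (f (set_spin s v k) * heat_bath_at v f s))).
  apply: eq_expect => s; rewrite expr2 {1}/heat_bath_at mulr_suml.
  by apply: eq_bigr => k _; rewrite mulrA.
rewrite (heat_bath_exchange v (fun s t => f t * heat_bath_at v f s)).
apply: eq_expect => s; under eq_bigr do rewrite heat_bath_at_set_spin.
by rewrite -mulr_suml sum_local_prob mul1r.
Qed.

(** After [local_prob_ge] has replaced the uniform law by the conditional one, expanding the square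
    and using stationarity gives exactly the right-hand side. *)
Lemma heat_bath_at_dirichlet v f :
  expR (- (beta * D%:R)) * site_form E beta v f <=
  2 * (expect mu (fun s => f s ^+ 2) - expect mu (fun s => f s * heat_bath_at v f s)).
Proof.
apply: le_trans (_ : expect mu (fun s => \sum_k local_prob v s k *
    (f (set_spin s v k) - f s) ^+ 2) <= _).
  rewrite /site_form -expectZ; apply: ler_expect => [s|s]; first exact: gibbs_ge0.
  rewrite mulrA mulr_sumr; apply: ler_sum => k _.
  by rewrite ler_wpM2r ?sqr_ge0// local_prob_ge.
rewrite le_eqVlt; apply/orP; left; apply/eqP.
rewrite (eq_expect _ (g := fun s => heat_bath_at v (fun t => f t ^+ 2) s +
           (f s ^+ 2 + -2 * (f s * heat_bath_at v f s)))).
  by rewrite !expectD expectZ expect_heat_bath_at; ring.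
move=> s; have -> : f s ^+ 2 = \sum_k local_prob v s k * f s ^+ 2.
  by rewrite -mulr_suml sum_local_prob mul1r.
rewrite /heat_bath_at !mulr_sumr -!big_split; apply: eq_bigr => k _ /=; ring.
Qed.

Lemma heat_bathE f s :
  chain_op (heat_bath E beta) f s = #|V|%:R^-1 * \sum_v heat_bath_at v f s.
Proof.
rewrite /chain_op /expect /heat_bath.
under eq_bigr => s' _ do rewrite mulr_suml.
rewrite exchange_big mulr_sumr; apply: eq_bigr => v _ /=.
under eq_bigr => s' _ do rewrite -mulrA mulr_suml.
rewrite -mulr_sumr exchange_big; congr (_ * _); apply: eq_bigr => k _ /=.
rewrite -/(local_prob v s k) (bigD1 (set_spin s v k))//= eqxx mulr1 big1 ?addr0// => s' /negPf ->.
by rewrite mulr0 mul0r.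
Qed.

Lemma heat_bath_stationary f :
  expect mu (chain_op (heat_bath E beta) f) = expect mu f.
Proof.
rewrite (eq_expect _ (heat_bathE f)) expectZ expect_sum.
rewrite (eq_bigr (fun=> expect mu f)) => [|v _]; last exact: expect_heat_bath_at.
by rewrite sumr_const -[expect mu f *+ _]mulr_natl mulrA mulVf ?mul1r// gt_eqF.
Qed.

(** The chain operator is an average of projections; Cauchy-Schwarz bounds the square of the average
    by the average of the squares. *)
Lemma heat_bath_positive f :
  expect mu (fun s => chain_op (heat_bath E beta) f s ^+ 2) <=
  expect mu (fun s => f s * chain_op (heat_bath E beta) f s).
Proof.
rewrite [leRHS](eq_expect _ (g := fun s => #|V|%:R^-1 *
    \sum_v f s * heat_bath_at v f s)); last first.
  by move=> s; rewrite heat_bathE mulrCA mulr_sumr.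
rewrite expectZ expect_sum; under eq_bigr do rewrite -expect_heat_bath_at_sqr.
rewrite -expect_sum -expectZ; apply: ler_expect => s; first exact: gibbs_ge0.
rewrite heat_bathE exprMn; set S := \sum_v _.
rewrite expr2 -mulrA ler_wpM2l ?invr_ge0 ?ler0n//.
by rewrite mulrC ler_pdivrMr// mulrC sqr_sum_le.
Qed.

Section Gap.
Variables (r : V -> nat) (w : nat).
Hypothesis r_inj : injective r.
Hypothesis r_lt : forall v, (r v < #|V|)%N.
Hypothesis cut_le : forall i, (#|cut_edges E r i| <= w)%N.

Lemma heat_bath_poincare f :
  expR (- (beta * D%:R)) * expR (- (2 * beta * w%:R)) / #|V|%:R ^+ 2
    * variance mu f <=
  expect mu (fun s => f s ^+ 2) -
  expect mu (fun s => f s * chain_op (heat_bath E beta) f s).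
Proof.
have -> : expect mu (fun s => f s * chain_op (heat_bath E beta) f s) =
   #|V|%:R^-1 * \sum_v expect mu (fun s => f s * heat_bath_at v f s).
  rewrite -expect_sum -expectZ; apply: eq_expect => s.
  by rewrite heat_bathE mulrCA mulr_sumr.
apply: (poincare_of_site_forms q_gt0 beta_ge0 r_inj r_lt cut_le V_gt0).
  exact: expR_gt0.
rewrite mulrBr [_ * (_^-1 * _)]mulrA divff ?gt_eqF// mul1r.
rewrite (_ : _ - _ = \sum_v (expect mu (fun s => f s ^+ 2) -
    expect mu (fun s => f s * heat_bath_at v f s))); last first.
  by rewrite sumrB sumr_const mulr_natl.
rewrite !mulr_sumr.
by apply: ler_sum => v _; apply: heat_bath_at_dirichlet.
Qed.

End Gap.
End HeatBath.

(** * Edwards-Sokal coupling *)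

Section Percolation.
Variables (R : comPzRingType) (T : finType) (a b : R).
Implicit Types (A M S : {set T}).

Lemma sum_percolation M :
  \sum_(A : {set T} | A \subset M) a ^+ #|A| * b ^+ #|M :\: A| = (a + b) ^+ #|M|.
Proof.
pose F i := if i \in M then a else 0; pose G i := if i \in M then b else 1.
transitivity (\prod_i (F i + G i)); last first.
  rewrite -prodr_const [RHS]big_mkcond; apply: eq_bigr => i _.
  by rewrite /F /G; case: ifP; rewrite ?add0r.
rewrite bigA_distr big_mkcond; apply: eq_bigr => A _.
case: ifPn => [AM|/subsetPn[i iA iM]]; last first.
  by rewrite (bigD1 i)//= iA /F (negPf iM) mul0r.
rewrite (bigID (mem A))/=; congr (_ * _).
  rewrite -prodr_const; apply: eq_bigr => i iA.
  by rewrite iA /F (subsetP AM).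
rewrite -prodr_const big_mkcond [RHS]big_mkcond; apply: eq_bigr => i _.
by rewrite inE /G; case: (i \in A); case: (i \in M).
Qed.

(** The admissible [A] are the subsets of [M :\: S], and the deleted edges in [M :&: S] factor out.
    For [a + b = 1] this is the probability that no edge of [S] is kept. *)
Lemma sum_percolation_disjoint M S :
  \sum_(A : {set T} | (A \subset M) && [disjoint A & S])
     a ^+ #|A| * b ^+ #|M :\: A| = (a + b) ^+ #|M :\: S| * b ^+ #|M :&: S|.
Proof.
rewrite -sum_percolation mulr_suml; apply: eq_big => [A|A /andP[AM AS]].
  by rewrite subsetD.
rewrite -mulrA -exprD; congr (_ * _ ^+ _).
rewrite -(cardsID S (M :\: A)) addnC; congr (_ + _)%N.
  by rewrite !setDDl setUC.
apply: eq_card => i; rewrite !inE.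
by have [iS|] := boolP (i \in S); rewrite ?andbF// (disjointFl AS iS).
Qed.

End Percolation.

(** * Connected components and the recolouring law *)

Section Components.
Variables (R : realType) (V : finType) (q : nat).
Hypothesis q_gt0 : (0 < q)%N.
Local Notation config := (spin_config V q).
Implicit Types (s : config) (A : {set {set V}}) (v x y : V) (k : 'I_q).

Definition edge_rel A : rel V := [rel x y | [set x; y] \in A].

Definition component A v : {set V} := [set y | connect (edge_rel A) v y].

Lemma connect_edge_sym A : connect_sym (edge_rel A).
Proof. by apply: sym_connect_sym => x y; rewrite /edge_rel /= setUC. Qed.

Lemma mem_component A v : v \in component A v.
Proof. by rewrite inE connect0. Qed.

Lemma componentsP A C :
  reflect (exists v, C = component A v) (C \in components A).
Proof.
apply: (iffP imsetP) => [[v _ ->]|[v ->]]; exists v => //;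
  by apply/setP => y; rewrite !inE.
Qed.

Lemma component_eq A v x : x \in component A v -> component A x = component A v.
Proof.
rewrite inE => vx; apply/setP => y; rewrite !inE.
by rewrite (same_connect (connect_edge_sym A) vx).
Qed.

Lemma connect_const A s x y : (forall x y, [set x; y] \in A -> s x = s y) ->
  connect (edge_rel A) x y -> s x = s y.
Proof.
move=> sA /connectP[p]; elim: p x => [x _ -> //|z p IH x /= /andP[/sA -> ]].
exact: IH.
Qed.

(** For each component only one colour can contribute to the sum over [k], so the law is uniform on
    the configurations that are constant on components. *)
Lemma recolour_probE A s : recolour_prob R A s =
  q%:R^-1 ^+ #|components A| * [forall C in components A, monochromatic s C]%:R.
Proof.
transitivity (\prod_(C in components A) (q%:R^-1 * (monochromatic s C)%:R : R)).
  apply: eq_bigr => C /componentsP[v ->]; rewrite -mulr_sumr; congr (_ * _).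
  have vC := mem_component A v; set C' := component A v in vC *.
  rewrite (bigD1 (s v))//= big1 ?addr0 => [|k /eqP k_s].
    congr (_%:R); congr nat_of_bool; apply/forall_inP/forall_inP => h x xC.
      by apply/forall_inP => y yC; rewrite (eqP (h x xC)) (eqP (h y yC)).
    by have /forall_inP/(_ _ vC) := h x xC.
  case: forall_inP => // /(_ _ vC)/eqP sk.
  by rewrite sk in k_s.
rewrite big_split prodr_const; congr (_ * _).
case: forall_inP => [h|/forall_inP]; first by apply: big1 => C /h ->.
by case/forall_inPn => C CA /negPf Cs; rewrite (bigD1 C)//= Cs mul0r.
Qed.

Lemma recolour_prob_ge0 A s : 0 <= recolour_prob R A s.
Proof. by rewrite recolour_probE mulr_ge0 ?ler0n// exprn_ge0// invr_ge0 ler0n. Qed.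

Lemma sum_recolour_prob A : \sum_(s : config) recolour_prob R A s = 1.
Proof.
(* The condition is void off the components, so the product may run over all sets of sites and
   expand into a sum over all colourings [f] of sets. *)
pose G (s : config) C k : bool := (C \in components A) ==> [forall x in C, s x == k].
transitivity (\sum_(s : config) \prod_(C : {set V}) \sum_k q%:R^-1 * (G s C k)%:R : R).
  apply: eq_bigr => s _; rewrite /recolour_prob big_mkcond; apply: eq_bigr => C _.
  rewrite /G; case: (C \in components A) => //=.
  by rewrite -mulr_suml sum_uniform_spin// mul1r.
under eq_bigr => s _ do rewrite bigA_distr_bigA.
rewrite exchange_big /=.
transitivity (\sum_(f : {ffun {set V} -> 'I_q}) \prod_(C : {set V}) (q%:R^-1 : R)).
  apply: eq_bigr => f _; under eq_bigr => s _ do rewrite big_split.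
  rewrite -mulr_sumr; suff -> : \sum_s \prod_C ((G s C (f C))%:R : R) = 1 by rewrite mulr1.
  (* The only configuration that follows [f] on every component. *)
  pose s0 : config := [ffun x => f (component A x)].
  rewrite (bigD1 s0)//= big1 ?big1 ?addr0// => [s|C _].
    move=> /eqP s_neq; have [x sx] : exists x, s x != s0 x.
      apply/existsP; rewrite -negb_forall; apply/negP => /forallP h.
      by apply: s_neq; apply/ffunP => x; apply/eqP.
    rewrite (bigD1 (component A x))//= /G.
    have -> : component A x \in components A by apply/componentsP; exists x.
    case: forall_inP => [/(_ _ (mem_component A x))|]; last by rewrite mul0r.
    by move=> /eqP sx'; rewrite sx' ffunE eqxx in sx.
  suff -> : G s0 C (f C) by [].
  apply/implyP => /componentsP[v ->]; apply/forall_inP => x xv.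
  by rewrite ffunE (component_eq xv).
rewrite -(bigA_distr_bigA (fun _ _ => q%:R^-1)) big1// => C _.
exact: sum_uniform_spin.
Qed.

End Components.

Section SwendsenWang.
Variables (R : realType) (V : finType) (E : {set {set V}}).
Variables (q : nat) (beta : R).
Hypothesis q_gt0 : (0 < q)%N.
Hypothesis beta_ge0 : 0 <= beta.
Hypothesis E2 : forall e, e \in E -> #|e| = 2.

Local Notation config := (spin_config V q).
Local Notation mu := (@gibbs R V E q beta).
Local Notation p := (1 - expR (- beta)).
Local Notation rec := (recolour_prob R).
Implicit Types (s t : config) (f g : config -> R) (v : V) (k l : 'I_q).
Implicit Types (A : {set {set V}}).

Let qR_gt0 : 0 < q%:R :> R. Proof. by rewrite ltr0n. Qed.

Lemma p_ge0 : 0 <= p.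
Proof. by rewrite subr_ge0 expR_le1 oppr_le0. Qed.

Lemma pC : 1 - p = expR (- beta).
Proof. by ring. Qed.

Lemma mono_edges_sub s : mono_edges E s \subset E.
Proof. by apply/subsetP => e; rewrite inE => /andP[]. Qed.

Lemma mono_edgesP A s : A \subset E ->
  reflect (forall x y, [set x; y] \in A -> s x = s y) (A \subset mono_edges E s).
Proof.
move=> AE; apply: (iffP subsetP) => [h x y /h|h e eA].
  by rewrite inE monochromatic2 => /andP[_ /eqP].
have eE := subsetP AE e eA.
rewrite inE eE /=; have /cards2P[x [y [_ exy]]] : #|e| == 2 by rewrite E2.
by rewrite exy monochromatic2; apply/eqP/h; rewrite -exy.
Qed.

(** Agreement along the edges of [A] is the same as agreement on its components; this identifies the
    recolouring law with the law of the spins given the edges. *)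
Lemma recolour_prob_compat A s : A \subset E ->
  rec A s = q%:R^-1 ^+ #|components A| * (A \subset mono_edges E s)%:R.
Proof.
move=> AE; rewrite recolour_probE; congr (_ * _%:R); congr nat_of_bool.
apply/forall_inP/mono_edgesP => // [h x y xyA|h C /componentsP[v ->]].
  have : component A x \in components A by apply/componentsP; exists x.
  move=> /h/forall_inP/(_ _ (mem_component A x))/forall_inP/(_ y) hy.
  by apply/eqP/hy; rewrite inE; apply: connect1.
apply/forall_inP => x; rewrite inE => vx; apply/forall_inP => y; rewrite inE => vy.
by rewrite -(connect_const h vx) -(connect_const h vy).
Qed.

Definition component_avg A v f s : R := q%:R^-1 * \sum_k f (set_block s (component A v) k).

(** The law [rec A] is uniform on the configurations compatible with [A], and recolouring a whole
    component preserves compatibility. *)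
Lemma expect_component_avg A v f : A \subset E ->
  expect (rec A) (component_avg A v f) = expect (rec A) f.
Proof.
move=> AE; set C := component A v.
pose Q s := A \subset mono_edges E s.
have expQ g : expect (rec A) g = q%:R^-1 ^+ #|components A| * \sum_(s | Q s) g s.
  rewrite mulr_sumr [RHS]big_mkcond; apply: eq_bigr => s _.
  rewrite recolour_prob_compat// -/(Q s).
  by case: (Q s); rewrite ?mulr1// mulr0 mul0r.
rewrite !expQ; congr (_ * _); rewrite -mulr_sumr.
rewrite -(@sum_set_block _ _ _ C v Q (fun s _ => f s)).
- under eq_bigr do rewrite sumr_const card_ord -[_ *+ _]mulr_natl.
  by rewrite -mulr_sumr mulrA mulVf ?mul1r// gt_eqF.
- exact: mem_component.
- move=> s k /mono_edgesP -/(_ AE) h; apply/mono_edgesP => // x y xyA.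
  have xyC : (x \in C) = (y \in C).
    rewrite !inE ![connect _ v _]connect_edge_sym.
    exact: (same_connect (connect_edge_sym A) (connect1 (xyA : edge_rel A x y)) v).
  by rewrite !ffunE xyC (h x y xyA).
- move=> s /mono_edgesP -/(_ AE) h x; rewrite inE => vx.
  by rewrite (connect_const h vx).
Qed.

Lemma isolated_component A v : A \subset E -> [disjoint A & star E v] ->
  component A v = [set v].
Proof.
move=> AE Av; apply/setP => y; rewrite !inE; apply/idP/eqP => [|->]; last exact: connect0.
move=> /connectP[[|z l] /=]; first by [].
move=> /andP[vzA _]; have := disjointFr Av vzA.
by rewrite inE (subsetP AE _ vzA) set21.
Qed.

Definition sw_prob s A : R := p ^+ #|A| * (1 - p) ^+ #|mono_edges E s :\: A|.

Lemma sw_prob_ge0 s A : 0 <= sw_prob s A.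
Proof. by rewrite mulr_ge0// exprn_ge0 ?p_ge0// pC expR_ge0. Qed.

Lemma sum_sw_prob s : \sum_(A : {set {set V}} | A \subset mono_edges E s) sw_prob s A = 1.
Proof. by rewrite sum_percolation addrC subrK expr1n. Qed.

(** At most [D] monochromatic edges meet [v], and each is deleted with probability
    [expR (- beta)]. *)
Lemma sw_isolated s v D : (#|star E v| <= D)%N ->
  expR (- (beta * D%:R)) <=
  \sum_(A : {set {set V}} | (A \subset mono_edges E s) && [disjoint A & star E v]) sw_prob s A.
Proof.
move=> degv; rewrite sum_percolation_disjoint addrC subrK expr1n mul1r pC.
rewrite -expRM_natr ler_expR mulNr lerN2 ler_wpM2l// ler_nat.
by apply: leq_trans degv; rewrite subset_leq_card// subsetIr.
Qed.

Lemma swendsen_wangE f s : chain_op (swendsen_wang E beta) f s =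
  \sum_(A : {set {set V}} | A \subset mono_edges E s) sw_prob s A * expect (rec A) f.
Proof.
rewrite /chain_op /expect /swendsen_wang.
under eq_bigr => s' _ do rewrite mulr_suml.
rewrite exchange_big; apply: eq_bigr => A _ /=.
by rewrite mulr_sumr; apply: eq_bigr => s' _; rewrite mulrA.
Qed.

(* The random cluster measure on edge sets, i.e. the second marginal of the
   Edwards-Sokal coupling of which [mu] is the first one. *)
Definition cluster_weight A : R :=
  p ^+ #|A| * (1 - p) ^+ #|E :\: A| * q%:R ^+ #|components A| /
  \sum_(s : config) potts_weight E beta s.

Lemma cluster_weight_ge0 A : 0 <= cluster_weight A.
Proof.
rewrite divr_ge0 ?(ltW (partition_gt0 _ _ _))//.
by rewrite !mulr_ge0// exprn_ge0 ?p_ge0 ?ler0n// pC expR_ge0.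
Qed.

Lemma potts_weightE s : potts_weight E beta s = (1 - p) ^+ #|E :\: mono_edges E s|.
Proof.
rewrite pC -expRM_natr; congr (expR (_ * _)).
rewrite /potts_energy -sum1_card natr_sum big_mkcond [RHS]big_mkcond; apply: eq_bigr => e _.
rewrite !inE; case: (e \in E) => //=.
by case: (monochromatic s e); rewrite /= ?subrr ?subr0.
Qed.

(** Both sides are the joint law of spins and edges: the disagreeing edges and the deleted ones make
    up [E :\: A], and the power of [q] cancels against the recolouring law. *)
Lemma edwards_sokal s A : A \subset mono_edges E s ->
  mu s * sw_prob s A = cluster_weight A * rec A s.
Proof.
move=> As; have sE := mono_edges_sub s; have AE := subset_trans As sE.
rewrite recolour_prob_compat// As mulr1 /gibbs /cluster_weight potts_weightE /sw_prob.
have -> : #|E :\: A| = (#|E :\: mono_edges E s| + #|mono_edges E s :\: A|)%N.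
  rewrite -(cardsID (mono_edges E s) (E :\: A)) addnC; congr (_ + _)%N.
    by rewrite setDDl (setUidPr As).
  by apply: eq_card => e; rewrite !inE; case: (e \in E); case: (e \in A).
have Z0 := gt_eqF (partition_gt0 E beta q_gt0).
have Q0 : q%:R ^+ #|components A| != 0 :> R by rewrite expf_neq0// gt_eqF.
rewrite exprD exprVn; move: (_ ^+ #|E :\: _|) (_ ^+ #|_ :\: A|) (_ ^+ #|A|) Q0.
move: (_ ^+ #|components A|) (\sum_s' _) Z0 => y Z /negbT Z0 u u' a y0.
by field; rewrite y0.
Qed.

(** Sampling the spins first or the edges first gives the same coupling; [Q] serves to restrict it
    to edge sets that isolate a site. *)
Lemma sw_exchange (F : config -> {set {set V}} -> R) (Q : pred {set {set V}}) :
  expect mu (fun s => \sum_(A : {set {set V}} | (A \subset mono_edges E s) && Q A)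
                        sw_prob s A * F s A) =
  \sum_(A : {set {set V}} | (A \subset E) && Q A) cluster_weight A * expect (rec A) (F^~ A).
Proof.
rewrite /expect; under eq_bigr => s _ do rewrite mulr_sumr.
under [RHS]eq_bigr => A _ do rewrite mulr_sumr.
rewrite [RHS]exchange_big; apply: eq_bigr => s _ /=.
rewrite big_mkcond [RHS]big_mkcond; apply: eq_bigr => A _.
have [AE|AE] := boolP (A \subset E); last first.
  case: ifP => //= /andP[As _].
  by rewrite (subset_trans As (mono_edges_sub s)) in AE.
have [As|As] := boolP (A \subset mono_edges E s) => /=.
  by case: ifP => // _; rewrite mulrA edwards_sokal// -mulrA.
case: ifP => // _.
by rewrite recolour_prob_compat// (negPf As) mulr0 mul0r mulr0.
Qed.

End SwendsenWang.

(** * Swendsen-Wang chain *)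

Section Drift.
Variables (R : realFieldType) (Omega : finType).
Implicit Types (nu f : Omega -> R).

Lemma ler_norm_expect nu f : (forall s, 0 <= nu s) ->
  `|expect nu f| <= expect nu (fun s => `|f s|).
Proof.
move=> nu0; apply: le_trans (ler_norm_sum _ _ _) _.
by apply: ler_sum => s _; rewrite normrM ger0_norm.
Qed.

Lemma ler_norm_expectB nu f c (g : Omega -> R) :
  (forall s, 0 <= nu s) -> \sum_s nu s = 1 ->
  (forall s, `|f s - c| <= g s) -> `|expect nu f - c| <= expect nu g.
Proof.
move=> nu0 nu1 fc; rewrite -{1}(expect_cst nu1 c) -mulN1r -expectZ -expectD.
apply: le_trans (ler_norm_expect _ nu0) _; apply: ler_expect => // s.
by rewrite mulN1r.
Qed.

End Drift.

(** * Convergence from a drift condition *)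

Section DriftChain.
Variables (R : realType) (Omega : finType) (P : Omega -> Omega -> R).
Implicit Types (f : Omega -> R).
Hypothesis P_ge0 : forall s s', 0 <= P s s'.
Hypothesis P1 : forall s, \sum_s' P s s' = 1.
Variables (N : Omega -> R) (a b : R).
Hypothesis a_gt0 : 0 < a.
Hypothesis a_le1 : a <= 1.
Hypothesis drift : forall s, chain_op P N s <= (1 - a) * N s + b.

(** The deviation is dominated by the mean of [N] after [t] steps, and [b / a] is the fixed point of
    the affine drift. *)
Lemma drift_iter f c t s : (forall s, `|f s - c| <= N s) ->
  `|iter t (chain_op P) f s - c| <= (1 - a) ^+ t * N s + (1 - (1 - a) ^+ t) * (b / a).
Proof.
move=> fN; elim: t s => [|t IH] s; first by rewrite subrr mul0r addr0 mul1r fN.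
rewrite iterS exprS; set y := (1 - a) ^+ t in IH *.
apply: le_trans (ler_norm_expectB (P_ge0 s) (P1 s) IH) _.
rewrite expectD expectZ expect_cst//.
have y0 : 0 <= y by rewrite exprn_ge0// subr_ge0.
have := ler_wpM2l y0 (drift s); rewrite /chain_op => h.
apply: le_trans (lerD h (lexx _)) _; rewrite le_eqVlt; apply/orP; left; apply/eqP.
by field; rewrite gt_eqF.
Qed.

End DriftChain.

Section SwendsenWangGap.
Variables (R : realType) (V : finType) (E : {set {set V}}).
Variables (q : nat) (beta : R).
Hypothesis q_gt0 : (0 < q)%N.
Hypothesis beta_ge0 : 0 <= beta.
Hypothesis E2 : forall e, e \in E -> #|e| = 2.
Hypothesis V_gt0 : (0 < #|V|)%N.
Variable D : nat.
Hypothesis degree_le : forall v, (#|star E v| <= D)%N.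

Local Notation config := (spin_config V q).
Local Notation mu := (@gibbs R V E q beta).
Local Notation SW := (@swendsen_wang R V E q beta).
Local Notation phi := (cluster_weight E q beta).
Local Notation rec := (@recolour_prob R V q).
Local Notation sw_prob := (sw_prob E beta).
Implicit Types (s t : config) (f g : config -> R) (v x : V) (k l : 'I_q).
Implicit Types (A : {set {set V}}).

Let qR_gt0 : 0 < q%:R :> R. Proof. by rewrite ltr0n. Qed.
Let rec1 A : \sum_(s : config) rec A s = 1. Proof. exact: sum_recolour_prob. Qed.
Let rec0 A s : 0 <= rec A s. Proof. exact: recolour_prob_ge0. Qed.

Lemma swendsen_wang_ge0 s s' : 0 <= SW s s'.
Proof.
apply: sumr_ge0 => A _; apply: mulr_ge0; last exact: rec0.
exact: (sw_prob_ge0 E beta_ge0 s A).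
Qed.

Lemma swendsen_wang_stochastic s : \sum_s' SW s s' = 1.
Proof.
transitivity (chain_op SW (fun=> 1) s).
  by apply: eq_bigr => s' _; rewrite mulr1.
rewrite swendsen_wangE -[RHS](sum_sw_prob E beta s).
by apply: eq_bigr => A _; rewrite expect_cst// mulr1.
Qed.

Lemma sw_exchangeT (F : config -> {set {set V}} -> R) :
  expect mu (fun s => \sum_(A : {set {set V}} | A \subset mono_edges E s)
                        sw_prob s A * F s A) =
  \sum_(A : {set {set V}} | A \subset E) phi A * expect (rec A) (F^~ A).
Proof.
have := sw_exchange beta q_gt0 E2 F xpredT.
under [X in _ = X]eq_bigl do rewrite andbT; move=> <-; apply: eq_expect => s.
by apply: eq_bigl => A; rewrite andbT.
Qed.

Lemma expect_cluster f :
  expect mu f = \sum_(A : {set {set V}} | A \subset E) phi A * expect (rec A) f.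
Proof.
rewrite -(sw_exchangeT (fun s _ => f s)); apply: eq_expect => s.
by rewrite -mulr_suml sum_sw_prob mul1r.
Qed.

Lemma swendsen_wang_stationary f : expect mu (chain_op SW f) = expect mu f.
Proof.
rewrite (eq_expect _ (swendsen_wangE E beta f)).
rewrite (sw_exchangeT (fun _ A => expect (rec A) f)) expect_cluster.
by apply: eq_bigr => A _; rewrite expect_cst.
Qed.

(** The chain goes from spins to edges and back, so its quadratic form is the mean square of the
    conditional expectation given the edges. *)
Lemma expect_mul_swendsen_wang f :
  expect mu (fun s => f s * chain_op SW f s) =
  \sum_(A : {set {set V}} | A \subset E) phi A * expect (rec A) f ^+ 2.
Proof.
rewrite (eq_bigr (fun A => phi A * expect (rec A) (fun s => f s * expect (rec A) f))).
  rewrite -sw_exchangeT; apply: eq_expect => s; rewrite swendsen_wangE mulr_sumr.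
  by apply: eq_bigr => A _; rewrite mulrCA.
move=> A _; rewrite expr2 -expectZ; congr (_ * _); apply: eq_expect => s.
exact: mulrC.
Qed.

(** Given [s], one step averages [expect (rec A) f] over the random [A]; Jensen moves the square
    inside that average. *)
Lemma swendsen_wang_positive f :
  expect mu (fun s => chain_op SW f s ^+ 2) <=
  expect mu (fun s => f s * chain_op SW f s).
Proof.
rewrite expect_mul_swendsen_wang.
apply: le_trans (_ : expect mu (fun s =>
    \sum_(A : {set {set V}} | A \subset mono_edges E s)
       sw_prob s A * expect (rec A) f ^+ 2) <= _); last first.
  rewrite (sw_exchangeT (fun _ A => expect (rec A) f ^+ 2)).
  by apply: ler_sum => A _; rewrite expect_cst.
apply: ler_expect => s; first exact: gibbs_ge0.
pose nu A := if A \subset mono_edges E s then sw_prob s A else 0.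
have nuE (h : {set {set V}} -> R) : expect nu h =
    \sum_(A : {set {set V}} | A \subset mono_edges E s) sw_prob s A * h A.
  rewrite [RHS]big_mkcond; apply: eq_bigr => A _; rewrite /nu.
  by case: ifP; rewrite ?mul0r.
rewrite swendsen_wangE -(nuE (fun A => expect (rec A) f)).
rewrite -(nuE (fun A => expect (rec A) f ^+ 2)).
apply: expect_sqr_le => [A|].
  by rewrite /nu; case: ifP => // _; exact: sw_prob_ge0.
by rewrite -[RHS](sum_sw_prob E beta s) [RHS]big_mkcond.
Qed.

(** The law of total variance: the Dirichlet form is the mean conditional variance given the
    edges. *)
Lemma swendsen_wang_dirichlet f :
  expect mu (fun s => f s ^+ 2) - expect mu (fun s => f s * chain_op SW f s) =
  \sum_(A : {set {set V}} | A \subset E) phi A * variance (rec A) f.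
Proof.
rewrite expect_mul_swendsen_wang (expect_cluster (fun s => f s ^+ 2)) -sumrB.
by apply: eq_bigr => A _; rewrite varianceE// mulrBr.
Qed.

(** Under [rec A] an isolated site has a uniform spin independent of the others, so [U] below is the
    conditional expectation given the other spins. The left side is twice the mean conditional
    variance, which the full variance dominates. *)
Lemma isolated_variance A v f : A \subset E -> [disjoint A & star E v] ->
  expect (rec A) (fun s => q%:R^-1 * \sum_k (f (set_spin s v k) - f s) ^+ 2)
  <= 2 * variance (rec A) f.
Proof.
move=> AE Av; pose U g s := q%:R^-1 * \sum_k g (set_spin s v k).
have EU g : expect (rec A) (U g) = expect (rec A) g.
  rewrite -(expect_component_avg q_gt0 E2 v g AE); apply: eq_expect => s.
  rewrite /component_avg (isolated_component AE Av); congr (_ * _).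
  by apply: eq_bigr => k _; rewrite set_spinE.
have EfU : expect (rec A) (fun s => f s * U f s) = expect (rec A) (fun s => U f s ^+ 2).
  rewrite -EU; apply: eq_expect => s; rewrite /U expr2 -mulrA mulr_suml; congr (_ * _).
  apply: eq_bigr => k _; congr (_ * (_ * _)).
  by apply: eq_bigr => l _; rewrite set_spin_spin.
have := expect_sqr_le (rec0 A) (rec1 A) (U f); rewrite -EfU EU => h.
rewrite varianceE// (eq_expect _ (g := fun s => U (fun t => f t ^+ 2) s +
    (f s ^+ 2 + - 2 * (f s * U f s)))).
  by rewrite !expectD EU expectZ; lra.
move=> s; have -> : f s ^+ 2 = q%:R^-1 * \sum_(k : 'I_q) f s ^+ 2.
  by rewrite sumr_const card_ord -[f s ^+ 2 *+ q]mulr_natl mulKf// gt_eqF.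
rewrite /U !mulr_sumr -!big_split; apply: eq_bigr => k _ /=; ring.
Qed.

(** Inserts the event that [v] is isolated, of conditional probability at least
    [expR (- (beta * D))], and drops the nonnegative variances of the other edge sets. *)
Lemma swendsen_wang_site_form v f :
  expR (- (beta * D%:R)) * site_form E beta v f <=
  2 * (expect mu (fun s => f s ^+ 2) - expect mu (fun s => f s * chain_op SW f s)).
Proof.
pose G s := q%:R^-1 * \sum_k (f (set_spin s v k) - f s) ^+ 2.
have G0 s : 0 <= G s.
  by rewrite mulr_ge0 ?invr_ge0 ?ler0n// sumr_ge0// => k _; apply: sqr_ge0.
rewrite /site_form -/G -expectZ.
pose iso A := [disjoint A & star E v].
apply: le_trans (_ : expect mu (fun s => \sum_(A : {set {set V}} |
    (A \subset mono_edges E s) && iso A) sw_prob s A * G s) <= _).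
  apply: ler_expect => s; first exact: gibbs_ge0.
  by rewrite -mulr_suml ler_wpM2r// sw_isolated.
rewrite (sw_exchange beta q_gt0 E2 (fun s _ => G s) iso).
rewrite swendsen_wang_dirichlet mulr_sumr [leRHS](bigID iso)/=.
rewrite -[leLHS]addr0; apply: lerD.
  apply: ler_sum => A /andP[AE Av].
  by rewrite [leRHS]mulrCA ler_wpM2l ?cluster_weight_ge0// isolated_variance.
apply: sumr_ge0 => A _; apply: mulr_ge0 => //; apply: mulr_ge0.
  exact: cluster_weight_ge0.
exact: (variance_ge0 (rec0 A)).
Qed.

Section Gap.
Variables (r : V -> nat) (w : nat).
Hypothesis r_inj : injective r.
Hypothesis r_lt : forall v, (r v < #|V|)%N.
Hypothesis cut_le : forall i, (#|cut_edges E r i| <= w)%N.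

Lemma swendsen_wang_poincare f :
  expR (- (beta * D%:R)) * expR (- (2 * beta * w%:R)) / #|V|%:R ^+ 2
    * variance mu f <=
  expect mu (fun s => f s ^+ 2) - expect mu (fun s => f s * chain_op SW f s).
Proof.
apply: (poincare_of_site_forms q_gt0 beta_ge0 r_inj r_lt cut_le V_gt0).
  exact: expR_gt0.
rewrite [#|V|%:R * _]mulr_natl -[X in _ <= 2 * X](sumr_const V) !mulr_sumr.
by apply: ler_sum => v _; apply: swendsen_wang_site_form.
Qed.

End Gap.

(** Vanishes on rainbow configurations and is at least 1 on all others, so it bounds the indicator
    of not being rainbow. *)
Definition coincidences s : R := \sum_v \sum_(x | x != v) (s v == s x)%:R.

Lemma coincidences_ge0 s : 0 <= coincidences s.
Proof. by apply: sumr_ge0 => v _; apply: sumr_ge0 => x _; apply: ler0n. Qed.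

Lemma coincidences_le s : coincidences s <= #|V|%:R ^+ 2.
Proof.
apply: le_trans (_ : \sum_(v : V) \sum_(x : V) 1 <= _).
  apply: ler_sum => v _; rewrite big_mkcond; apply: ler_sum => x _.
  by case: ifP => // _; rewrite lern1 leq_b1.
by rewrite !sumr_const -natrX -mulrnA mulnn.
Qed.

(** Sites in different components agree with probability exactly [1 / q]: averaging over the colour
    of the component of [v] alone shows it. *)
Lemma expect_recolour_eq A v x : A \subset E ->
  expect (rec A) (fun s => (s v == s x)%:R) <=
  q%:R^-1 + (connect (edge_rel A) v x)%:R.
Proof.
move=> AE; have [vx|vx] := boolP (connect _ v x).
  rewrite -[leLHS]add0r; apply: lerD; first by rewrite invr_ge0 ler0n.
  rewrite -[leRHS](expect_cst (rec1 A)); apply: ler_expect => // s.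
  by rewrite lern1 leq_b1.
rewrite addr0 -(expect_component_avg q_gt0 E2 v _ AE) -[leRHS](expect_cst (rec1 A)).
rewrite le_eqVlt; apply/orP; left; apply/eqP/eq_expect => s.
rewrite /component_avg (bigD1 (s x))//= big1 => [|k kx].
  by rewrite !ffunE mem_component inE (negPf vx) eqxx addr0 mulr1.
by rewrite !ffunE mem_component inE (negPf vx) (negPf kx).
Qed.

(** After a step two sites agree either by chance, with probability at most [1 / q], or because they
    are connected; the latter forces them to agree beforehand and [v] not to be isolated. *)
Lemma coincidences_drift s :
  chain_op SW coincidences s <=
  (1 - expR (- (beta * D%:R))) * coincidences s + #|V|%:R ^+ 2 / q%:R.
Proof.
set a := expR _; pose M := mono_edges E s.
pose pr (Q : pred {set {set V}}) :=
  \sum_(A : {set {set V}} | A \subset M) sw_prob s A * (Q A)%:R.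
have pair v x : x != v ->
    pr (fun A => connect (edge_rel A) v x) <= (1 - a) * (s v == s x)%:R.
  move=> xv; have [svx|svx] := eqVneq (s v) (s x); last first.
    rewrite mulr0 /pr big1// => A As; case: (boolP (connect _ v x)) => [vx|]; last by rewrite mulr0.
    have AE := subset_trans As (mono_edges_sub E s).
    have /mono_edgesP -/(_ E2 AE) h := As.
    by rewrite (connect_const h vx) eqxx in svx.
  rewrite mulr1 lerBrDr.
  apply: le_trans (_ : _ <= pr (fun A => connect (edge_rel A) v x) + _) _.
    by rewrite lerD2l; apply: (sw_isolated beta_ge0 s (degree_le v)).
  rewrite -[leRHS](sum_sw_prob E beta s) [X in _ + X <= _]big_mkcondr /pr -big_split.
  apply: ler_sum => A As /=; have AE := subset_trans As (mono_edges_sub E s).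
  have := sw_prob_ge0 E beta_ge0 s A.
  case: ifPn => Av; last by case: connect => /=; lra.
  suff /negPf -> : ~~ connect (edge_rel A) v x by rewrite mulr0 add0r.
  by apply/negP => vx; have := isolated_component AE Av => /setP/(_ x);
    rewrite !inE vx (negPf xv).
have step v x : x != v -> \sum_(A : {set {set V}} | A \subset M)
    sw_prob s A * expect (rec A) (fun s => (s v == s x)%:R) <=
    (1 - a) * (s v == s x)%:R + q%:R^-1.
  move=> xv; apply: le_trans (lerD (pair v x xv) (lexx _)).
  have -> : q%:R^-1 = \sum_(A : {set {set V}} | A \subset M) sw_prob s A * q%:R^-1.
    by rewrite -mulr_suml sum_sw_prob mul1r.
  rewrite -big_split.
  apply: ler_sum => A As /=; rewrite -mulrDr ler_wpM2l ?sw_prob_ge0// [leRHS]addrC.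
  by rewrite expect_recolour_eq// (subset_trans As (mono_edges_sub E s)).
rewrite swendsen_wangE.
under eq_bigr => A _.
  rewrite expect_sum mulr_sumr.
  under eq_bigr => v _ do rewrite expect_sum mulr_sumr.
  over.
rewrite exchange_big.
apply: le_trans (_ : \sum_v \sum_(x | x != v) ((1 - a) * (s v == s x)%:R + q%:R^-1) <= _).
  by apply: ler_sum => v _; rewrite exchange_big; apply: ler_sum => x /step.
under eq_bigr do rewrite big_split.
rewrite big_split /= mulr_sumr; apply: lerD.
  by apply: ler_sum => v _; rewrite mulr_sumr.
apply: le_trans (_ : \sum_(v : V) \sum_(x : V) q%:R^-1 <= _).
  apply: ler_sum => v _; rewrite big_mkcond; apply: ler_sum => x _.
  by case: ifP => // _; rewrite invr_ge0 ler0n.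
by rewrite !sumr_const -[X in X <= _]mulrnA mulnn -natrX mulr_natl.
Qed.

(** Without monochromatic edges the percolation set is empty and every site is recoloured afresh.
    Otherwise the left side is at most 1, which [coincidences] exceeds or equals. *)
Lemma rainbow_step g s : (forall s, 0 <= g s <= 1) ->
  `|chain_op SW g s - expect (rec set0) g| <= coincidences s.
Proof.
move=> g01; have E01 nu : (forall s, 0 <= nu s) -> \sum_s nu s = 1 ->
    0 <= expect nu g <= 1.
  move=> nu0 nu1; rewrite expect_ge0 => [|//|t]; last by case/andP: (g01 t).
  by rewrite -[leRHS](expect_cst nu1) ler_expect// => t; case/andP: (g01 t).
have [s1|s0] := boolP [exists v, exists x, (x != v) && (s v == s x)].
  apply: le_trans (_ : 1 <= _).
    rewrite /chain_op.
    have := E01 _ (swendsen_wang_ge0 s) (swendsen_wang_stochastic s).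
    have := E01 _ (rec0 set0) (rec1 set0); rewrite ler_norml; lra.
  case/existsP: s1 => v /existsP[x /andP[xv svx]].
  rewrite /coincidences (bigD1 v)//= (bigD1 x)//= svx -addrA lerDl addr_ge0//.
    by apply: sumr_ge0 => y _; apply: ler0n.
  by apply: sumr_ge0 => y _; apply: sumr_ge0 => z _; apply: ler0n.
suff M0 : mono_edges E s = set0.
  rewrite swendsen_wangE M0 (bigD1 set0)//= big1 => [|A]; last first.
    by rewrite subset0 => /andP[->].
  rewrite /swendsen_wang /sw_prob M0 set0D cards0 !expr0 !mul1r addr0 subrr normr0.
  exact: coincidences_ge0.
apply/eqP; rewrite -subset0; apply/subsetP => e; rewrite !inE => /andP[eE].
have /cards2P[v [x [vx ->]]] : #|e| == 2 by rewrite E2.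
rewrite monochromatic2 => svx; case/negP: s0.
by apply/existsP; exists v; apply/existsP; exists x; rewrite eq_sym vx.
Qed.

Lemma swendsen_wang_mixing_large_q (t : nat) :
  #|V|%:R ^+ 2 * (1 - expR (- (beta * D%:R))) ^+ t <= 32^-1 ->
  32 * #|V|%:R ^+ 2 * expR (beta * D%:R) <= q%:R ->
  (mixing_time SW mu <= t.+1%:R%:E)%E.
Proof.
set a := expR (- _) => ht hq; apply: mixing_time_le8 => s A.
have a0 : 0 < a by apply: expR_gt0.
have a1 : a <= 1 by rewrite expR_le1 oppr_le0 mulr_ge0.
pose c := expect (rec set0) (indic R A).
(* The decayed initial count and the level [b / a] of the drift give [1/32] each; replacing [c] by
   the equilibrium mean doubles the error to [1/8]. *)
have bound s' : `|iter t.+1 (chain_op SW) (indic R A) s' - c| <= 16^-1.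
  (* The rainbow step is the last step of the chain, hence the innermost application of the
     operator. *)
  rewrite iterSr.
  have fN s0 : `|chain_op SW (indic R A) s0 - c| <= coincidences s0.
    by apply: rainbow_step => s''; rewrite indic_ge0 indic_le1.
  apply: le_trans (drift_iter swendsen_wang_ge0 swendsen_wang_stochastic a0 a1
    coincidences_drift t s' fN) _.
  have y0 : 0 <= (1 - a) ^+ t by rewrite exprn_ge0// subr_ge0.
  have h1 := ler_wpM2l y0 (coincidences_le s').
  have h2 : #|V|%:R ^+ 2 / q%:R / a <= 32^-1 :> R.
    rewrite ler_pdivrMr// ler_pdivrMr// /a expRN.
    rewrite mulrAC -ler_pdivrMr ?invr_gt0 ?expR_gt0// invrK.
    by rewrite ler_pdivlMl//; lra.
  have h3 : 0 <= #|V|%:R ^+ 2 / q%:R / a :> R.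
    by rewrite !divr_ge0 ?sqr_ge0 ?ler0n// ltW.
  move: y0 h1 ht h2 h3; rewrite [#|V|%:R ^+ 2 * _]mulrC.
  move: (_ / a) ((1 - a) ^+ t) => z y; nra.
have := ler_norm_expectB (gibbs_ge0 E beta q_gt0) (sum_gibbs _ _ q_gt0) bound.
rewrite (expect_iter swendsen_wang_stationary) expect_cst; last exact: sum_gibbs.
have := bound s; rewrite !ler_norml; lra.
Qed.

End SwendsenWangGap.

(** * Heat bath chain for large q *)

Section HeatBathLargeQ.
Variables (R : realType) (V : finType) (E : {set {set V}}).
Variables (q : nat) (beta : R).
Hypothesis q_gt0 : (0 < q)%N.
Hypothesis beta_ge0 : 0 <= beta.
Hypothesis E2 : forall e, e \in E -> #|e| = 2.
Hypothesis V_gt0 : (0 < #|V|)%N.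
Variable D : nat.
Hypothesis degree_le : forall v, (#|star E v| <= D)%N.
Variable r : V -> nat.
Hypothesis r_inj : injective r.
Hypothesis r_lt : forall v, (r v < #|V|)%N.

Local Notation config := (spin_config V q).
Local Notation mu := (@gibbs R V E q beta).
Local Notation HB := (@heat_bath R V E q beta).
Local Notation W := (local_weight E beta).
Local Notation n := (#|V|%:R : R).
Local Notation B := (expR (beta * D%:R)).
Implicit Types (s : config) (f : config -> R) (u v : V) (j k : 'I_q).

Let qR_gt0 : 0 < q%:R :> R. Proof. by rewrite ltr0n. Qed.
Let n_gt0 : 0 < n. Proof. by rewrite ltr0n. Qed.

Definition site_lipschitz (K : R) f : Prop :=
  forall s v k, `|f (set_spin s v k) - f s| <= K.

Lemma lipschitz_ge0 K f : site_lipschitz K f -> 0 <= K.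
Proof.
have /card_gt0P[v _] := V_gt0.
by move=> /(_ [ffun=> Ordinal q_gt0] v (Ordinal q_gt0)); apply: le_trans.
Qed.

Lemma lipschitz_osc K f s t : site_lipschitz K f -> `|f t - f s| <= n * K.
Proof.
move=> fK; rewrite (mix_telescope r_inj r_lt); apply: le_trans (ler_norm_sum _ _ _) _.
rewrite mulr_natl -(sumr_const V); apply: ler_sum => v _.
by rewrite mix_succ.
Qed.

(** Changing the spin at [u] alters the weights of the colours [s u] and [j] only, each by at most
    [B]. Numerators and normalisation thus cost [2 * B] each, over a normalisation of at least
    [q]. *)
Lemma local_prob_lipschitz s u v j :
  \sum_k `|local_prob E beta v (set_spin s u j) k - local_prob E beta v s k|
  <= 4 * B / q%:R.
Proof.
set s' := set_spin s u j; set Z := \sum_k W s v k; set Z' := \sum_k W s' v k.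
have Z0 : 0 < Z by apply: local_weight_sum_gt0.
have Z'0 : 0 < Z' by apply: local_weight_sum_gt0.
have dW : \sum_k `|W s' v k - W s v k| <= 2 * B.
  apply: le_trans (_ : \sum_k ((k == s u)%:R * B + (k == j)%:R * B) <= _).
    apply: ler_sum => k _.
    have [kj|kj] := boolP ((k == s u) || (k == j)).
      apply: le_trans (_ : B <= _).
        have := local_weight_le beta_ge0 E2 degree_le s v k.
        have := local_weight_le beta_ge0 E2 degree_le s' v k.
        have := local_weight_gt0 E beta s v k.
        have := local_weight_gt0 E beta s' v k; rewrite ler_norml; lra.
      have B0 : 0 <= B by apply: expR_ge0.
      by case/orP: kj => ->; case: (_ == _) => /=; lra.
    rewrite negb_or in kj; case/andP: kj => ks kj.
    suff -> : W s' v k = W s v k.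
      by rewrite subrr normr0 addr_ge0// mulr_ge0 ?ler0n ?expR_ge0.
    congr (expR (_ * _)); apply: eq_bigr => x _; rewrite ffunE.
    by case: (eqVneq x u) => // ->; rewrite (negPf ks) (negPf kj).
  rewrite big_split /= -!mulr_suml.
  have one i : \sum_(k : 'I_q) (k == i)%:R = 1 :> R.
    by rewrite (bigD1 i)//= eqxx big1 ?addr0// => k /negPf ->.
  by rewrite !one; lra.
have dZ : `|Z - Z'| <= 2 * B.
  by rewrite distrC -sumrB; apply: le_trans (ler_norm_sum _ _ _) dW.
apply: le_trans (_ : \sum_k (`|W s' v k - W s v k| +
   local_prob E beta v s k * `|Z - Z'|) / Z' <= _).
  apply: ler_sum => k _.
  have -> : local_prob E beta v s' k - local_prob E beta v s k =
    ((W s' v k - W s v k) + local_prob E beta v s k * (Z - Z')) / Z'.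
    rewrite /local_prob -/Z -/Z'; field.
    by rewrite !gt_eqF.
  rewrite normrM [`|_^-1|]gtr0_norm ?invr_gt0// ler_wpM2r ?invr_ge0 ?(ltW Z'0)//.
  apply: le_trans (ler_normD _ _) _; rewrite lerD2l normrM ger0_norm//.
  exact: local_prob_ge0.
rewrite -mulr_suml big_split /= -mulr_suml sum_local_prob// mul1r.
apply: ler_pM; rewrite ?invr_ge0 ?(ltW Z'0)//.
- by rewrite addr_ge0// sumr_ge0.
- by lra.
- by rewrite lef_pV2 ?posrE// local_weight_sum_ge.
Qed.

(** Updating the discrepant site erases the discrepancy. Otherwise the difference splits into a
    change at [u] under a fixed new spin and a change in the law of that spin; the latter may be
    centred at [f s], as both laws have mass 1. *)
Lemma heat_bath_at_lipschitz K f v s u j : site_lipschitz K f ->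
  `|heat_bath_at E beta v f (set_spin s u j) - heat_bath_at E beta v f s|
  <= if u == v then 0 else K * (1 + 4 * B / q%:R).
Proof.
move=> fK; have K0 := lipschitz_ge0 fK.
have [<-|uv] := eqVneq; first by rewrite heat_bath_at_set_spin// subrr normr0.
set s' := set_spin s u j; pose p := @local_prob R V E q beta v.
have -> : heat_bath_at E beta v f s' - heat_bath_at E beta v f s =
    \sum_k p s' k * (f (set_spin s' v k) - f (set_spin s v k)) +
    \sum_k (p s' k - p s k) * (f (set_spin s v k) - f s).
  rewrite -sumrB -big_split /=.
  have -> : \sum_k ((p s' k * (f (set_spin s' v k) - f (set_spin s v k))) +
      (p s' k - p s k) * (f (set_spin s v k) - f s)) =
      \sum_k (p s' k * f (set_spin s' v k) - p s k * f (set_spin s v k))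
      - (\sum_k p s' k - \sum_k p s k) * f s.
    by rewrite -sumrB mulr_suml -sumrB; apply: eq_bigr => k _; ring.
  by rewrite !sum_local_prob// subrr mul0r subr0.
apply: le_trans (ler_normD _ _) _; rewrite mulrDr mulr1; apply: lerD.
  apply: le_trans (ler_norm_sum _ _ _) _.
  rewrite -[leRHS]mul1r -(sum_local_prob E q_gt0 beta_ge0 v s') mulr_suml.
  apply: ler_sum => k _; rewrite normrM ger0_norm ?local_prob_ge0//.
  rewrite ler_wpM2l ?local_prob_ge0//.
  suff -> : set_spin s' v k = set_spin (set_spin s v k) u j by apply: fK.
  apply/ffunP => x; rewrite !ffunE; case: (eqVneq x v) => // ->.
  by rewrite eq_sym (negPf uv).
apply: le_trans (ler_norm_sum _ _ _) _.
apply: le_trans (ler_wpM2l K0 (local_prob_lipschitz s u v j)); rewrite mulr_sumr.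
by apply: ler_sum => k _; rewrite normrM mulrC ler_wpM2r.
Qed.

Hypothesis q_large : 8 * n * B <= q%:R.

(** Of the [n] possible updates the one at [u] costs nothing and the others at most
    [K * (1 + 1 / (2 * n))]; the gain from the first outweighs the excess of the rest. *)
Lemma heat_bath_lipschitz K f : site_lipschitz K f ->
  site_lipschitz (K * (1 - (2 * n)^-1)) (chain_op HB f).
Proof.
move=> fK s u j; have K0 := lipschitz_ge0 fK.
rewrite !heat_bathE -mulrBr -sumrB normrM ger0_norm ?invr_ge0 ?ler0n//.
have d_le : 4 * B / q%:R <= (2 * n)^-1.
  rewrite ler_pdivrMr// ler_pdivlMl ?mulr_gt0//.
  by rewrite (_ : 2 * n * (4 * B) = 8 * n * B)//; ring.
rewrite ler_pdivrMl//; apply: le_trans (ler_norm_sum _ _ _) _.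
apply: le_trans (_ : \sum_(v | v != u) K * (1 + (2 * n)^-1) <= _).
  rewrite [leRHS]big_mkcond; apply: ler_sum => v _.
  apply: le_trans (heat_bath_at_lipschitz v s u j fK) _; rewrite eq_sym.
  by case: eqP => //= _; rewrite ler_wpM2l// lerD2l.
rewrite sumr_const cardC1 -[_ *+ #|V|.-1]mulr_natl.
have -> : #|V|.-1%:R = n - 1 :> R by rewrite -[in RHS](prednK V_gt0) -natr1 addrK.
have -> : (n - 1) * (K * (1 + (2 * n)^-1)) =
   n * (K * (1 - (2 * n)^-1)) - K / (2 * n) by field; rewrite gt_eqF.
by rewrite gerBl divr_ge0// mulr_ge0// ltW.
Qed.

Lemma heat_bath_mixing_large_q (t : nat) :
  n * (1 - (2 * n)^-1) ^+ t <= 8^-1 -> (mixing_time HB mu <= t%:R%:E)%E.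
Proof.
move=> ht; apply: mixing_time_le8 => s A.
have lip : site_lipschitz ((1 - (2 * n)^-1) ^+ t) (iter t (chain_op HB) (indic R A)).
  elim: (t) => [|t' IH] /=.
    move=> s' v k; have := indic_le1 R A s'; have := indic_ge0 R A s'.
    have := indic_le1 R A (set_spin s' v k); have := indic_ge0 R A (set_spin s' v k).
    by rewrite expr0 ler_norml; lra.
  by rewrite exprSr; apply: heat_bath_lipschitz.
set g := iter t _ _ in lip *.
rewrite -(expect_iter (heat_bath_stationary q_gt0 beta_ge0 E2 V_gt0) t) -/g.
apply: le_trans ht; set c := n * _.
have h s' : `|g s' - g s| <= c by apply: lipschitz_osc.
have := ler_norm_expectB (gibbs_ge0 E beta q_gt0) (sum_gibbs E beta q_gt0) h.
by rewrite expect_cst// sum_gibbs.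
Qed.

End HeatBathLargeQ.

(** * Cut width of the torus *)

Section Digits.
Variable L : nat.
Implicit Types (f g : nat -> nat).

Lemma digits_lt f m : (0 < L)%N -> (forall k, f k < L)%N ->
  (\sum_(k < m) f k * L ^ k < L ^ m)%N.
Proof.
move=> L0 fL; elim: m => [|m IH]; first by rewrite big_ord0 expn0.
rewrite big_ord_recr /= expnS (leq_trans (n := L ^ m + f m * L ^ m))%N ?ltn_add2r//.
by rewrite -mulSn leq_mul2r fL orbT.
Qed.

Lemma digits_inj f g m : (0 < L)%N -> (forall k, f k < L)%N -> (forall k, g k < L)%N ->
  (\sum_(k < m) f k * L ^ k = \sum_(k < m) g k * L ^ k)%N ->
  forall k, (k < m)%N -> f k = g k.
Proof.
move=> L0 fL gL; elim: m => [//|m IH]; rewrite !big_ord_recr /= => eq_fg.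
have Lm0 : (0 < L ^ m)%N by rewrite expn_gt0 L0.
have fgm : f m = g m.
  have := congr1 (divn^~ (L ^ m))%N eq_fg.
  by rewrite !(addnC (\sum_(_ < _) _)%N) !divnMDl// !divn_small ?digits_lt// !addn0.
move=> k; rewrite ltnS leq_eqVlt => /orP[/eqP -> //|]; apply: IH.
by move: eq_fg; rewrite fgm => /addIn.
Qed.

End Digits.

Section TorusCut.
Variables (L d : nat).
Hypothesis L_gt0 : (0 < L)%N.
Local Notation T := (torus_vertex L d).
Implicit Types (x y : T) (j : 'I_d).

(** Indexed by [nat], with default 0 beyond the last coordinate, to fit the lemmas on base [L]
    expansions. *)
Definition digit x (k : nat) : nat := if insub k is Some j then x j else 0.

Lemma digitE x j : digit x j = x j.
Proof. by rewrite /digit valK. Qed.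

Lemma digit_lt x k : (digit x k < L)%N.
Proof. by rewrite /digit; case: insub. Qed.

(** The lexicographic order with the last coordinate most significant. *)
Definition rank x : nat := \sum_(k < d) digit x k * L ^ k.

Lemma rank_lt x : (rank x < #|T|)%N.
Proof. by rewrite card_ffun !card_ord digits_lt//; apply: digit_lt. Qed.

Lemma rank_inj : injective rank.
Proof.
move=> x y /(digits_inj L_gt0 (digit_lt x) (digit_lt y)) xy.
by apply/ffunP => j; apply: val_inj; rewrite /= -!digitE xy.
Qed.

Definition low_digits x (m : nat) : nat := \sum_(k < m) digit x k * L ^ k.

Lemma rank_split x j : exists hi,
  rank x = (low_digits x j + x j * L ^ j + hi * L ^ j.+1)%N.
Proof.
exists (\sum_(k < d | j < k) digit x k * L ^ (k - j.+1))%N.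
rewrite /rank (bigID (fun k : 'I_d => (k < j)%N))/= -addnA; congr (_ + _)%N.
  by rewrite /low_digits (big_ord_widen d (fun k => digit x k * L ^ k)%N) ?(ltnW (ltn_ord j)).
rewrite (bigD1 j) ?ltnn//= digitE; congr (_ + _)%N.
rewrite big_distrl /=; apply: eq_big => k; first by rewrite -leqNgt ltn_neqAle eq_sym andbC.
by rewrite -leqNgt => /andP[jk kj]; rewrite -mulnA -expnD subnK// ltn_neqAle eq_sym kj.
Qed.

Definition shift x j (k : 'I_L) : T := [ffun i => if i == j then k else x i].

Lemma rank_shift x j k : (rank (shift x j k) + x j * L ^ j = rank x + k * L ^ j)%N.
Proof.
rewrite /rank (bigD1 j)//= [in RHS](bigD1 j)//= !digitE ffunE eqxx.
rewrite (eq_bigr (fun i : 'I_d => digit x i * L ^ i)%N); last first.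
  by move=> i /negPf ij; rewrite !digitE ffunE ij.
by rewrite addnAC [in LHS](addnC (k * _)%N) addnAC.
Qed.

Lemma card_le_window (X : {set T}) (h : T -> nat) (a m : nat) :
  {in X &, injective h} -> {in X, forall x, a <= h x < a + m}%N -> (#|X| <= m)%N.
Proof.
move=> h_inj hX; rewrite cardE -(size_map h) -(size_iota a m); apply: uniq_leq_size.
  rewrite map_inj_in_uniq ?enum_uniq// => x y; rewrite !mem_enum; exact: h_inj.
by move=> _ /mapP[x + ->]; rewrite mem_enum mem_iota => /hX.
Qed.

(* The two ways in which an edge in direction j can cross level i upwards: by
   an ordinary step, or by the wrap-around edge from digit 0 to digit L - 1. *)
Definition step_up (i : nat) j : {set T} :=
  [set x | rank x < i <= rank x + L ^ j]%N.

Definition wrap_up (i : nat) j : {set T} :=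
  [set x : T | (x j == 0 :> nat) && (rank x < i <= rank x + L.-1 * L ^ j)]%N.

Lemma card_step_up i j : (#|step_up i j| <= L ^ j)%N.
Proof.
have [iL|Li] := leqP (L ^ j) i.
  apply: (@card_le_window _ rank (i - L ^ j)); first by move=> x y _ _; apply: rank_inj.
  by move=> x; rewrite inE; lia.
apply: (@card_le_window _ rank 0); first by move=> x y _ _; apply: rank_inj.
by move=> x; rewrite inE; lia.
Qed.

(** Points with equal low digits, digit 0 at [j] and different higher digits have ranks at least
    [L ^ j.+1] apart, too far for both wrap-around edges to cross level [i]. So the low digits
    determine the point. *)
Lemma card_wrap_up i j : (#|wrap_up i j| <= L ^ j)%N.
Proof.
apply: (@card_le_window _ (low_digits^~ j) 0); last first.
  by move=> x _; rewrite add0n digits_lt//; apply: digit_lt.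
move=> x y; rewrite !inE => /andP[/eqP xj xi] /andP[/eqP yj yi] lo_xy.
apply: rank_inj; have [hx ex] := rank_split x j; have [hy ey] := rank_split y j.
rewrite ex ey lo_xy xj yj; rewrite ex xj lo_xy in xi; rewrite ey yj in yi.
have L1 : (L.-1 * L ^ j <= L ^ j.+1)%N by rewrite expnS leq_mul2r leq_pred orbT.
have [h|h|-> //] := ltngtP hx hy.
  have : (hx.+1 * L ^ j.+1 <= hy * L ^ j.+1)%N by rewrite leq_mul2r h orbT.
  rewrite mulSn; lia.
have : (hy.+1 * L ^ j.+1 <= hx * L ^ j.+1)%N by rewrite leq_mul2r h orbT.
rewrite mulSn; lia.
Qed.

Lemma torus_edgesP e : e \in torus_edges L d ->
  exists x y, [/\ e = [set x; y], x != y & torus_neighbour x y].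
Proof.
by case/imset2P => x y _; rewrite inE => /andP[xy nxy] ->; exists x, y.
Qed.

Lemma torus_edges2 e : e \in torus_edges L d -> #|e| = 2.
Proof. by move=> /torus_edgesP[x [y [-> xy _]]]; rewrite cards2 xy. Qed.

Lemma torus_neighbour_sym x y : torus_neighbour x y = torus_neighbour y x.
Proof.
apply: eq_existsb => i; rewrite orbC; congr (_ && _).
by apply: eq_forallb => j; rewrite [x j == _]eq_sym.
Qed.

(** Orient a cut edge from [x] up to [y] in rank. If [y j] follows [x j] cyclically, a wrap would
    lower the rank, so this is an ordinary step; if [x j] follows [y j], only a wrap can raise
    it. *)
Lemma cut_edges_sub i : cut_edges (torus_edges L d) rank i \subset
  \bigcup_j (((fun x => [set x; shift x j (ordS (x j))]) @: step_up i j) :|: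
             ((fun x => [set x; shift x j (ord_pred (x j))]) @: wrap_up i j)).
Proof.
apply/subsetP => e; rewrite inE => /andP[/torus_edgesP[a [b [-> _ nab]]]].
case/andP => /exists_inP[x xe xi] /exists_inP[y ye iy].
have xy_lt : (rank x < rank y)%N := leq_trans xi iy.
have [exy nxy] : [set a; b] = [set x; y] /\ torus_neighbour x y.
  move: xe ye; rewrite !inE => /orP[]/eqP ax /orP[]/eqP ay; move: xy_lt;
    rewrite ax ay ?ltnn//.
  by rewrite setUC torus_neighbour_sym nab.
rewrite exy; case/existsP: nxy => j /andP[/forallP off_j near].
apply/bigcupP; exists j => //.
have yE : y = shift x j (y j).
  apply/ffunP => k; rewrite ffunE; case: eqVneq => [-> //|kj].
  by have := off_j k; rewrite kj => /eqP.
have := rank_shift x j (y j); rewrite -yE.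
have up_le z : (rank y + z = rank x)%N -> false.
  by move=> yx; move: xy_lt; rewrite -yx ltnNge leq_addr.
case/orP: near => /eqP yj rk; rewrite inE; apply/orP; [left|right].
  apply/imsetP; exists x; last by rewrite -yj -yE.
  have := congr1 val yj; rewrite /= => yjv.
  rewrite inE xi /=.
  have [lt|ge] := ltnP (x j).+1 L.
    rewrite modn_small// in yjv; rewrite yjv mulSn addnA in rk.
    by rewrite -(addIn rk).
  have xL : (x j).+1 = L by apply/eqP; rewrite eqn_leq ge ltn_ord.
  by rewrite xL modnn in yjv; rewrite yjv mul0n addn0 in rk; have := up_le _ rk.
apply/imsetP; exists x; last by rewrite yj ordSK -yE.
have := congr1 val yj; rewrite /= => xjv.
rewrite inE xi /=.
have [lt|ge] := ltnP (y j).+1 L.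
  rewrite modn_small// in xjv; rewrite xjv mulSn addnA in rk.
  by have := up_le _ (addIn rk).
have yL : (y j).+1 = L by apply/eqP; rewrite eqn_leq ge ltn_ord.
rewrite yL modnn in xjv; rewrite xjv mul0n addn0 in rk; rewrite xjv eqxx /=.
by have -> : L.-1 = y j :> nat by [apply: (congr1 predn (esym yL))]; rewrite -rk.
Qed.

Lemma sum_expn_le m : (1 < L)%N -> (\sum_(j < m.+1) L ^ j <= 2 * L ^ m)%N.
Proof.
move=> L1; elim: m => [|m IH]; first by rewrite big_ord1.
rewrite big_ord_recr /= (leq_trans (leq_add IH (leqnn _)))//.
by rewrite [in leqRHS]mul2n -addnn leq_add2r expnS leq_mul2r L1 orbT.
Qed.

Lemma torus_cut_le i : (0 < d)%N ->
  (#|cut_edges (torus_edges L d) rank i| <= 4 * L ^ (d - 1))%N.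
Proof.
move=> d0; have [L1|L1] := leqP L 1.
  (* For [L = 1] the sum over directions would grow with [d], but then the torus has a single vertex
     and no edge. *)
  rewrite (_ : cut_edges _ _ _ = set0) ?cards0//; apply/setP => e.
  rewrite !inE; apply/negP => /andP[/torus_edgesP[x [y [_ /eqP xy _]]] _].
  apply: xy; apply/ffunP => j; apply: val_inj => /=.
  have ord_L1 (k : 'I_L) : k = 0 :> nat.
    by apply/eqP; rewrite -leqn0 -ltnS (leq_trans (ltn_ord k)).
  by rewrite !ord_L1.
apply: leq_trans (subset_leq_card (cut_edges_sub i)) _.
apply: leq_trans (_ : \sum_(j < d) 2 * L ^ j <= _)%N; last first.
  rewrite -big_distrr /= -(prednK d0) subn1 /= (leq_trans (leq_mul (leqnn 2) (sum_expn_le _ L1)))//.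
  by rewrite mulnA.
elim/big_rec2: _ => [|j m C _ IH]; first by rewrite cards0.
apply: leq_trans (leq_card_setU _ _) _; apply: leq_add => //.
apply: leq_trans (leq_card_setU _ _) _; rewrite mul2n -addnn; apply: leq_add.
  exact: leq_trans (leq_imset_card _ _) (card_step_up _ _).
exact: leq_trans (leq_imset_card _ _) (card_wrap_up _ _).
Qed.

End TorusCut.

(** * Mixing time bounds *)

(** Uses [1 - gamma <= expR (- gamma)] with [t] the integer part of [B / gamma] plus 1. *)
Lemma exists_relaxation_time (R : realType) (gamma B : R) :
  0 < gamma -> gamma <= 1 -> 0 <= B ->
  exists t : nat, (1 - gamma) ^+ t <= expR (- B) /\ t%:R <= B / gamma + 1.
Proof.
move=> g0 g1 B0; have Bg0 : 0 <= B / gamma by rewrite divr_ge0// ltW.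
have /andP[tB Bt] := truncn_itv Bg0.
exists (Num.truncn (B / gamma)).+1; split; last by rewrite -natr1 lerD2r.
apply: le_trans (_ : expR (- gamma) ^+ (Num.truncn (B / gamma)).+1 <= _).
  rewrite ler_pXn2r ?nnegrE ?expR_ge0 ?subr_ge0//.
  exact: expR_ge1Dx.
rewrite -expRM_natr ler_expR mulNr lerN2 mulrC -ler_pdivrMr//.
exact: ltW.
Qed.

Section PottsMixing.
Variables (R : realType) (V : finType) (E : {set {set V}}).
Variables (q : nat) (beta : R).
Hypothesis q_gt0 : (0 < q)%N.
Hypothesis beta_gt0 : 0 < beta.
Hypothesis E2 : forall e, e \in E -> #|e| = 2.
Hypothesis V_gt0 : (0 < #|V|)%N.
Variables (r : V -> nat) (l : nat).
Hypothesis r_inj : injective r.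
Hypothesis r_lt : forall v, (r v < #|V|)%N.
Hypothesis cut_le : forall i, (#|cut_edges E r i| <= 4 * l)%N.
Hypothesis V_le : (#|V| <= l ^ 2)%N.
Hypothesis l_gt0 : (0 < l)%N.

Local Notation mu := (@gibbs R V E q beta).
Local Notation HB := (@heat_bath R V E q beta).
Local Notation SW := (@swendsen_wang R V E q beta).
Local Notation n := (#|V|%:R : R).
Local Notation x := (l%:R : R).
Local Notation D := (2 * (4 * l))%N.
Local Notation a := (expR (- (beta * D%:R))).
Local Notation gamma := (a * expR (- (2 * beta * (4 * l)%:R)) / n ^+ 2).

(** Common unit of all estimates: each factor is at most a power of [Y], so that only exponents have
    to be added. *)
Let Y := expR ((1 + beta) * x).

Let beta_ge0 : 0 <= beta. Proof. exact: ltW. Qed.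
Let n_ge1 : 1 <= n. Proof. by rewrite ler1n. Qed.
Let x_ge1 : 1 <= x. Proof. by rewrite ler1n. Qed.
Let bx_ge0 : 0 <= beta * x. Proof. by rewrite mulr_ge0 ?ler0n. Qed.

Let degree_le v : (#|star E v| <= D)%N. Proof. exact: (card_star_le E2 r_inj cut_le). Qed.

Let Y_ge : 1 + x + beta * x <= Y.
Proof. by apply: le_trans (expR_ge1Dx _); lra. Qed.
Let Y_ge2 : 2 <= Y.
Proof. by have := Y_ge; have := x_ge1; have := bx_ge0; lra. Qed.
Let x_leY : x <= Y.
Proof. by have := Y_ge; have := x_ge1; have := bx_ge0; lra. Qed.
Let bx_leY : beta * x <= Y.
Proof. by have := Y_ge; have := x_ge1; have := bx_ge0; lra. Qed.
Let Y_ge0 : 0 <= Y.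
Proof. by have := Y_ge; have := x_ge1; have := bx_ge0; lra. Qed.

Let Y_ge1 : 1 <= Y.
Proof. by have := Y_ge2; lra. Qed.

Let Y_pow i j : (i <= j)%N -> Y ^+ i <= Y ^+ j.
Proof. exact: ler_weXn2l. Qed.

Let Y_double i : Y ^+ i + Y ^+ i <= Y ^+ i.+1.
Proof.
rewrite exprS -mulr2n -mulr_natl.
by rewrite ler_wpM2r// exprn_ge0.
Qed.

Let two_pow i : 2 ^+ i <= Y ^+ i.
Proof. by apply: lerXn2r; rewrite ?nnegrE. Qed.

Let n_leY : n <= Y ^+ 2.
Proof.
apply: le_trans (_ : x ^+ 2 <= _); first by rewrite -natrX ler_nat.
by rewrite ler_pXn2r ?nnegrE ?ler0n.
Qed.

Let exp_bx : expR (beta * x) <= Y.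
Proof. by rewrite ler_expR; have := x_ge1; lra. Qed.

Let a_inv : expR (beta * D%:R) <= Y ^+ 8.
Proof.
rewrite mulnA natrM (_ : beta * _ = beta * x * 8%:R); last by ring.
by rewrite expRM_natr ler_pXn2r ?nnegrE ?expR_ge0.
Qed.

Let a_le1 : a <= 1.
Proof. by rewrite expR_le1 oppr_le0 mulr_ge0 ?ler0n. Qed.

Let gamma_gt0 : 0 < gamma.
Proof. by rewrite divr_gt0 ?mulr_gt0 ?expR_gt0 ?exprn_gt0// ltr0n. Qed.

(** The degree factor and the canonical path factor cost [Y ^+ 8] each, and [n ^+ 2] costs
    [Y ^+ 4]. *)
Let gamma_inv : gamma^-1 <= Y ^+ 20.
Proof.
have n2 : n ^+ 2 <= Y ^+ 4 by rewrite (exprM Y 2 2) ler_pXn2r ?nnegrE ?ler0n ?exprn_ge0.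
rewrite invfM invrK invfM -!expRN !opprK.
have -> : 2 * beta * (4 * l)%:R = beta * D%:R by rewrite !natrM; ring.
rewrite (_ : 20 = 8 + 8 + 4)%N// !exprD.
by rewrite ler_pM ?mulr_ge0 ?expR_ge0 ?exprn_ge0 ?ler0n// ler_pM ?expR_ge0.
Qed.

Let gamma_le1 : gamma <= 1.
Proof.
rewrite ler_pdivrMr ?exprn_gt0 ?ltr0n// mul1r.
apply: le_trans (_ : 1 * 1 <= _).
  by rewrite ler_pM ?expR_ge0// expR_le1 oppr_le0 !mulr_ge0 ?ler0n.
by rewrite mul1r exprn_ege1.
Qed.

(** The threshold required by the large [q] argument for Swendsen-Wang; it exceeds the one for the
    heat bath. *)
Let Q := 32 * n ^+ 2 * expR (beta * D%:R).

Let Q_leY : Q <= Y ^+ 17.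
Proof.
have n2 : n ^+ 2 <= Y ^+ 4 by rewrite (exprM Y 2 2) ler_pXn2r ?nnegrE ?ler0n ?exprn_ge0.
have c : 32 <= Y ^+ 5 by apply: le_trans (two_pow 5); lra.
rewrite (_ : 17 = 5 + 4 + 8)%N// !exprD.
by rewrite ler_pM ?mulr_ge0 ?expR_ge0 ?exprn_ge0 ?ler0n// ler_pM ?exprn_ge0 ?ler0n.
Qed.

Let small_q_time : q%:R <= Q ->
  exists t : nat, (1 - gamma) ^+ t <= expR (- beta * #|E|%:R) / q%:R ^+ #|V| / 64
    /\ t%:R <= Y ^+ 42.
Proof.
(* Bounds the logarithm of 64 over the least mass of [mu], with 64 and [q] in place of their
   logarithms; since [q <= Q], this costs only a power of [Y]. *)
move=> qQ; pose B := 64 + beta * #|E|%:R + n * q%:R.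
have B0 : 0 <= B by rewrite !addr_ge0 ?mulr_ge0 ?ler0n.
have [t [ht tB]] := exists_relaxation_time gamma_gt0 gamma_le1 B0.
exists t; split.
  apply: le_trans ht _.
  rewrite (_ : - B = - beta * #|E|%:R + - (n * q%:R) + - 64); last by rewrite /B; ring.
  rewrite !expRD.
  have qR : 0 < q%:R :> R by rewrite ltr0n.
  have e_ge (z : R) : z <= expR z by apply: le_trans (expR_ge1Dx _); lra.
  apply: ler_pM; rewrite ?mulr_ge0 ?expR_ge0//.
    rewrite ler_wpM2l ?expR_ge0// expRN lef_pV2 ?posrE ?exprn_gt0 ?expR_gt0//.
    by rewrite mulrC expRM_natr ler_pXn2r ?nnegrE ?expR_ge0// ltW.
  by rewrite expRN lef_pV2 ?posrE ?expR_gt0.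
(* Three terms of at most [Y ^+ 19] each; dividing by [gamma] gives [Y ^+ 41], and the additional 1
   leads to the final exponent 42. *)
have B_le : B <= Y ^+ 21.
  have E_le : #|E|%:R <= n * (8 * x) :> R.
    by have := card_edges_le E2 r_inj cut_le; rewrite -!natrM ler_nat (mulnA 2 4).
  have h1 : 64 <= Y ^+ 19.
    by apply: le_trans (Y_pow (i := 6) _) => //; apply: le_trans (two_pow 6); lra.
  have h2 : beta * #|E|%:R <= Y ^+ 19.
    apply: le_trans (ler_wpM2l beta_ge0 E_le) _.
    rewrite (_ : beta * (n * (8 * x)) = 8 * n * (beta * x)); last by ring.
    apply: le_trans (_ : Y ^+ 3 * Y ^+ 2 * Y <= _); last first.
      by rewrite -exprD -exprSr Y_pow.
    have c : 8 <= Y ^+ 3 by apply: le_trans (two_pow 3); lra.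
    by rewrite ler_pM ?mulr_ge0 ?ler0n// ler_pM ?ler0n.
  have h3 : n * q%:R <= Y ^+ 19.
    rewrite (_ : 19 = 2 + 17)%N// exprD.
    by rewrite ler_pM ?ler0n// (le_trans qQ).
  have := Y_double 20; have := Y_double 19.
  have : 0 <= Y ^+ 19 by rewrite exprn_ge0.
  rewrite /B; lra.
have : B / gamma <= Y ^+ 41.
  by rewrite (_ : 41 = 21 + 20)%N// exprD ler_pM ?invr_ge0 ?(ltW gamma_gt0).
have := Y_double 41; have : 1 <= Y ^+ 41 by rewrite exprn_ege1.
lra.
Qed.

Lemma heat_bath_mixing_time :
  (mixing_time HB mu <= (expR ((42 + 42 * beta) * x))%:E)%E.
Proof.
have -> : expR ((42 + 42 * beta) * x) = Y ^+ 42.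
  by rewrite -expRM_natr; congr expR; ring.
suff [t mix_t tY] : exists2 t : nat, (mixing_time HB mu <= t%:R%:E)%E & t%:R <= Y ^+ 42.
  by apply: le_trans mix_t _; rewrite lee_fin.
have [qQ|Qq] := leP q%:R Q.
  have [t [ht tY]] := small_q_time qQ; exists t => //.
  apply: (mixing_time_poincare (gamma := gamma) _ _ _ _ _ _ _ _ ht) => //.
  - exact: gibbs_gt0.
  - exact: sum_gibbs.
  - exact: heat_bath_stationary.
  - exact: heat_bath_positive.
  - exact: (heat_bath_poincare q_gt0 beta_ge0 E2 V_gt0 degree_le r_inj r_lt cut_le).
  - by rewrite divr_gt0 ?expR_gt0 ?exprn_gt0// ltr0n.
  - exact: gibbs_ge.
have n0 : 0 < n by rewrite ltr0n.
have g0 : 0 < (2 * n)^-1 by rewrite invr_gt0 mulr_gt0.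
have g1 : (2 * n)^-1 <= 1 by rewrite invf_le1 ?mulr_gt0//; have := n_ge1; lra.
(* The exponent [8 * n] makes [n * expR (- (8 * n)) <= 1/8], as [8 * n <= expR (8 * n)]. *)
have B0 : 0 <= 8 * n by lra.
have [t [ht tB]] := exists_relaxation_time g0 g1 B0; exists t.
  apply: (heat_bath_mixing_large_q q_gt0 beta_ge0 E2 V_gt0 degree_le r_inj r_lt).
    apply: le_trans (ltW Qq); rewrite /Q ler_wpM2r ?expR_ge0//.
    by have := n_ge1; nra.
  apply: le_trans (ler_wpM2l (ltW n0) ht) _.
  rewrite expRN ler_pdivrMr ?expR_gt0//.
  have := expR_ge1Dx (8 * n); lra.
apply: le_trans tB _; rewrite invrK.
have c : 16 <= Y ^+ 4 by apply: le_trans (two_pow 4); lra.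
have h : 8 * n * (2 * n) <= Y ^+ 8.
  rewrite (_ : 8 * n * (2 * n) = 16 * (n * n)); last by ring.
  apply: le_trans (_ : Y ^+ 4 * (Y ^+ 2 * Y ^+ 2) <= _); last by rewrite -!exprD.
  by rewrite ler_pM ?mulr_ge0 ?ler0n// ler_pM ?ler0n.
have := Y_double 8; have : 1 <= Y ^+ 8 by rewrite exprn_ege1.
have := Y_pow (isT : (9 <= 42)%N); lra.
Qed.

Lemma swendsen_wang_mixing_time :
  (mixing_time SW mu <= (expR ((42 + 42 * beta) * x))%:E)%E.
Proof.
have -> : expR ((42 + 42 * beta) * x) = Y ^+ 42.
  by rewrite -expRM_natr; congr expR; ring.
suff [t mix_t tY] : exists2 t : nat, (mixing_time SW mu <= t%:R%:E)%E & t%:R <= Y ^+ 42.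
  by apply: le_trans mix_t _; rewrite lee_fin.
have [qQ|Qq] := leP q%:R Q.
  have [t [ht tY]] := small_q_time qQ; exists t => //.
  apply: (mixing_time_poincare (gamma := gamma) _ _ _ _ _ _ _ _ ht) => //.
  - exact: gibbs_gt0.
  - exact: sum_gibbs.
  - exact: swendsen_wang_stationary.
  - exact: swendsen_wang_positive.
  - exact: (swendsen_wang_poincare q_gt0 beta_ge0 E2 V_gt0 degree_le r_inj r_lt cut_le).
  - by rewrite divr_gt0 ?expR_gt0 ?exprn_gt0// ltr0n.
  - exact: gibbs_ge.
have a0 : 0 < a by apply: expR_gt0.
(* Likewise [n ^+ 2 * expR (- (32 * n ^+ 2)) <= 1/32]. *)
have B0 : 0 <= 32 * n ^+ 2 by rewrite mulr_ge0 ?exprn_ge0 ?ler0n.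
have [t [ht tB]] := exists_relaxation_time a0 a_le1 B0; exists t.+1.
  apply: (swendsen_wang_mixing_large_q q_gt0 beta_ge0 E2 degree_le); last exact: ltW.
  apply: le_trans (ler_wpM2l (exprn_ge0 2 (ler0n R _)) ht) _.
  rewrite expRN ler_pdivrMr ?expR_gt0//.
  have := expR_ge1Dx (32 * n ^+ 2); lra.
(* The left side is [Q] itself. *)
have : 32 * n ^+ 2 / a <= Y ^+ 17 by rewrite -expRN opprK.
have := Y_double 18; have := Y_double 17; have : 1 <= Y ^+ 17 by rewrite exprn_ege1.
have := Y_pow (isT : (19 <= 42)%N); rewrite -natr1; lra.
Qed.

End PottsMixing.

Theorem theorem1p1 (R : realType) :
  exists k1 k2 : R,
  forall (q : nat) (beta : R) (d L : nat),
    (0 < q)%N -> 0 < beta -> (2 <= d)%N -> (0 < L)%N ->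
    (tau_HB q beta L d
       <= (expR ((k1 + k2 * beta) * L%:R ^+ (d - 1)))%:E)%E /\
    (tau_SW q beta L d
       <= (expR ((k1 + k2 * beta) * L%:R ^+ (d - 1)))%:E)%E.
Proof.
exists 42, 42 => q beta d L q_gt0 beta_gt0 d_ge2 L_gt0.
have T_card : #|torus_vertex L d| = (L ^ d)%N by rewrite card_ffun !card_ord.
have T_gt0 : (0 < #|torus_vertex L d|)%N by rewrite T_card expn_gt0 L_gt0.
(* This is where [2 <= d] enters, as [d <= 2 * (d - 1)]. *)
have T_le : (#|torus_vertex L d| <= (L ^ (d - 1)) ^ 2)%N.
  by rewrite T_card -expnM leq_pexp2l//; lia.
have l_gt0 : (0 < L ^ (d - 1))%N by rewrite expn_gt0 L_gt0.
have cut i := torus_cut_le L_gt0 i (ltnW d_ge2).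
rewrite -natrX; split.
- exact: (heat_bath_mixing_time q_gt0 beta_gt0 (@torus_edges2 L d) T_gt0
    (rank_inj L_gt0) (rank_lt L_gt0) cut T_le l_gt0).
- exact: (swendsen_wang_mixing_time q_gt0 beta_gt0 (@torus_edges2 L d) T_gt0
    (rank_inj L_gt0) (rank_lt L_gt0) cut T_le l_gt0).
Qed.
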